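(* Let $k\ge 2$ and let $\vec c=(c_1,\ldots,c_k)$ be an integer vector with $c_1\ge c_2\ge\cdots\ge c_k$ and $c_k=1$. For $n\ge1$ let $R_n^{\vec c}\subseteq\mathbb Z^{k-1}$ be the finite set of vectors whose unique $\vec c$-SR has its last nonzero term at index exactly $n$, equipped with the uniform probability measure, and let $K_n^{\vec c}$ be the random variable on $R_n^{\vec c}$ giving the number of summands of the $\vec c$-SR. Then $\mathbb E[K_n^{\vec c}]$ and $\mathrm{Var}(K_n^{\vec c})$ are of order $n$ (i.e. each is $\Theta(n)$ as $n\to\infty$), and as $n\to\infty$, $K_n^{\vec c}$ converges to a Gaussian, i.e. $\bigl(K_n^{\vec c}-\mathbb E[K_n^{\vec c}]\bigr)/\sqrt{\mathrm{Var}(K_n^{\vec c})}$ converges in distribution to the standard normal distribution $N(0,1)$.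
   Context: The $\vec c$-recurrence vector sequence $(\vec X_n)_{n\in\mathbb Z}\subseteq\mathbb Z^{k-1}$ is defined by $\vec X_0=\vec 0$, $\vec X_{-i}=\vec e_i$ (the $i$-th standard basis vector) for $1\le i\le k-1$, and the recurrence $\vec X_n=c_1\vec X_{n-1}+c_2\vec X_{n-2}+\cdots+c_k\vec X_{n-k}$ for all $n\in\mathbb Z$. Since $c_k=1$, for negative indices this means $\vec X_n=\vec X_{n+k}-\sum_{i=1}^{k-1}c_i\vec X_{n+k-i}$ for all $n\le -k$. Satisfying sequences: let $a=(a_n)_{n=1}^\infty$ be a sequence of nonnegative integers with only finitely many nonzero terms. The property that $a$ is a $\vec c$-SR is defined recursively. The zero sequence is a $\vec c$-SR. If $a$ is nonzero, let $m$ be the largest index with $a_m>0$; then $a$ is a $\vec c$-SR if and only if at least one of the following holds: (i) $m<k$ and $a_n=c_n$ for all $1\le n\le m$; (ii) there exist $s\in\{1,\ldots,k\}$ and $\ell\ge 0$ such that $a_1=c_1,\ldots,a_{s-1}=c_{s-1}$, $a_s<c_s$, $a_{s+1}=\cdots=a_{s+\ell}=0$, and the shifted sequence $(a_{s+\ell+n})_{n=1}^\infty$ is a $\vec c$-SR. A $\vec c$-SR of $\vec v\in\mathbb Z^{k-1}$ is a sequence $a$ that is a $\vec c$-SR and satisfies $\vec v=\sum_{n\ge1}a_n\vec X_{-n}$. For weakly decreasing $\vec c$ with $c_k=1$, every $\vec v\in\mathbb Z^{k-1}$ has exactly one $\vec c$-SR. For $n\ge0$ let $D_n$ be the set of $\vec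 v\in\mathbb Z^{k-1}$ whose $\vec c$-SR $a$ satisfies $a_i=0$ for all $i>n$. Then $R_n^{\vec c}=D_n\setminus D_{n-1}$. For $\omega\in R_n^{\vec c}$ with $\vec c$-SR $a$, the number of summands is $K_n^{\vec c}(\omega)=\sum_{i\ge1}a_i$. *)

(* Defs.v *)
From HB Require Import structures.
From mathcomp Require Import all_boot all_order all_algebra.
From mathcomp Require Import all_classical all_reals all_analysis.

Set Implicit Arguments.
Unset Strict Implicit.
Unset Printing Implicit Defensive.

Import Order.TTheory GRing.Theory Num.Theory.
Import numFieldNormedType.Exports.

Local Open Scope classical_set_scope.
Local Open Scope ring_scope.

(* Sequences a_1, a_2, ... and vectors (c_1, ..., c_k) are indexed from 0:     *)
(* [a n] stands for a_(n+1) and [c i] stands for c_(i+1).                      *)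

(* Z^(k-1), as a type of its own so that it can carry the discrete             *)
(* sigma-algebra.                                                              *)
Definition Zvec (k : nat) : Type := 'rV[int]_k.-1.

HB.instance Definition _ k := GRing.Lmodule.copy (Zvec k) 'rV[int]_k.-1.
HB.instance Definition _ k := isPointed.Build (Zvec k) 0.
HB.instance Definition _ k := @isMeasurable.Build default_measure_display
  (Zvec k) discrete_measurable discrete_measurable0
  discrete_measurableC discrete_measurableU.

Lemma measurable_Zvec k (A : set (Zvec k)) : measurable A.
Proof. by []. Qed.

Definition is_recurrence_seq k (c : 'I_k -> int) (X : int -> Zvec k) : Prop :=
  [/\ X 0 = 0,
      forall i : 'I_k.-1, X (- (i.+1)%:Z) = delta_mx 0 i
    & forall n : int, X n = \sum_(i < k) c i *: X (n - (i.+1)%:Z)].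

Lemma recurrence_seq_exists k (c : 'I_k -> int) :
  (0 < k)%N -> (forall i : 'I_k, i.+1 = k -> c i = 1) ->
  exists X : int -> Zvec k, is_recurrence_seq c X.
Proof.
case: k c => // k c _ c1.
have {}c1 : c ord_max = 1 by exact: c1.
pose fwd (S : nat -> Zvec k.+1) i : Zvec k.+1 :=
  if i is j.+1 then S j else \sum_(j < k.+1) c j *: S j.
pose bwd (S : nat -> Zvec k.+1) i : Zvec k.+1 :=
  if i == k then S 0%N - \sum_(j < k) c (widen_ord (leqnSn k) j) *: S j.+1
  else S i.+1.
have fbK S i : (i <= k)%N -> fwd (bwd S) i = S i.
  case: i => [_|i ik] /=; last by rewrite /bwd ltn_eqF.
  rewrite big_ord_recr/= c1 scale1r {2}/bwd eqxx.
  rewrite (eq_bigr (fun j : 'I_k => c (widen_ord (leqnSn k) j) *: S j.+1)).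
    by rewrite addrC subrK.
  by move=> j _; rewrite /bwd /= ltn_eqF.
pose S0 (i : nat) : Zvec k.+1 :=
  if i is j.+1 then \row_l (val l == j)%:R else 0.
pose T (n : int) := match n with
  | Posz m => iter m fwd S0 | Negz m => iter m.+1 bwd S0 end.
have TE (n : int) i : (i <= k)%N -> T n i = fwd (T (n - 1)) i.
  case: n => [[|n]|n] ik.
  - by rewrite sub0r /= fbK.
  - by rewrite (_ : n.+1%:Z - 1 = n) // intS addrC addKr.
  - have -> : Negz n - 1 = Negz n.+1.
      by rewrite !NegzE [in RHS]intS opprD addrC.
    by rewrite -[LHS]fbK.
have TX i (n : int) : (i <= k)%N -> T n i = T (n - i%:Z) 0%N.
  elim: i n => [|i IH] n ik; first by rewrite subr0.
  by rewrite TE //= IH ?(ltnW ik)// intS opprD addrA.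
exists (fun n => T n 0%N); split => //.
- move=> i; rewrite -[- _]sub0r -TX ?ltn_ord//=.
  by apply/rowP => l; rewrite !mxE eqxx.
- move=> n; rewrite TE//=; apply: eq_bigr => i _.
  by rewrite TX ?leq_ord// [in RHS]intS opprD addrA.
Qed.

(* Finiteness of the support need not be required: being inductive, the        *)
(* predicate only holds of finitely supported sequences.                       *)
Inductive satisfying k (c : 'I_k -> int) : (nat -> nat) -> Prop :=
| SatZero (a : nat -> nat) of (forall n, a n = 0%N) : satisfying c a
| SatPrefix (a : nat -> nat) (p : nat) of
    (0 < a p)%N & (forall n, (p < n)%N -> a n = 0%N) &
    (p.+1 < k)%N & (forall i : 'I_k, (i <= p)%N -> (a i)%:Z = c i) :
    satisfying c a
| SatBlock (a : nat -> nat) (s : 'I_k) (l : nat) of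
    (exists n, (0 < a n)%N) &
    (forall i : 'I_k, (i < s)%N -> (a i)%:Z = c i) &
    (a s)%:Z < c s &
    (forall n, (s < n <= s + l)%N -> a n = 0%N) &
    satisfying c (fun n => a (s.+1 + l + n)%N) :
    satisfying c a.

Lemma satisfying_finite_support k (c : 'I_k -> int) a :
  satisfying c a -> exists N, forall n, (N <= n)%N -> a n = 0%N.
Proof.
elim=> {a} [a a0|a p _ ap _ _|a s l _ _ _ _ _ [N IH]].
- by exists 0%N.
- by exists p.+1.
- exists (s.+1 + l + N)%N => n Nn.
  rewrite -(subnKC (leq_trans (leq_addr N _) Nn)) IH//.
  by rewrite leq_subRL// (leq_trans (leq_addr N _) Nn).
Qed.

Section statistics.
Variables (k : nat) (c : 'I_k -> int) (X : int -> Zvec k).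

Definition is_SR (v : Zvec k) (a : nat -> nat) : Prop :=
  satisfying c a /\ v = \sum_(n \in [set: nat]) X (- (n.+1)%:Z) *+ a n.

(* "The" c-SR of v, picked by choice.                                          *)
Definition SR (v : Zvec k) : nat -> nat := xget (fun=> 0%N) [set a | is_SR v a].

Definition Dset (n : nat) : set (Zvec k) :=
  [set v | is_SR v (SR v) /\ forall i, (n <= i)%N -> SR v i = 0%N].

Definition Rset (n : nat) : set (Zvec k) := Dset n `\` Dset n.-1.

Definition summands (R : realType) (v : Zvec k) : R :=
  \sum_(i \in [set: nat]) ((SR v i)%:R : R).

End statistics.

(* The uniform probability measure on a finite nonempty set S (mnormalize      *)
(* falls back to a Dirac mass when S is empty or infinite).                    *)
Definition unif (R : realType) k (S : set (Zvec k)) : probability (Zvec k) R :=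
  mnormalize (mrestr (@counting (Zvec k) R) (measurable_Zvec S))
             (\d_ (point : Zvec k)).

Definition standardize (R : realType) k (P : probability (Zvec k) R)
    (K : Zvec k -> R) (v : Zvec k) : R :=
  (K v - fine 'E_P[K]%E) / Num.sqrt (fine 'V_P[K]%E).

Section measurability.
Variables (R : realType) (k : nat).

Let measurable_any (f : Zvec k -> R) : measurable_fun [set: Zvec k] f.
Proof. by move=> _ Y _; exact: measurable_Zvec. Qed.

HB.instance Definition _ (P : probability (Zvec k) R) (K : Zvec k -> R) :=
  isMeasurableFun.Build _ _ _ _ (standardize P K)
    (measurable_any (standardize P K)).

End measurability.

Definition cvg_in_distribution (R : realType) (d : measure_display)
    (T : measurableType d) (P : nat -> probability T R)
    (Z : forall n, {RV (P n) >-> R}) (nu : probability (measurableTypeR R) R) : Prop :=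
  forall x : R, {for x, continuous (fun y : R => nu `]-oo, y]%classic)} ->
    cdf (Z n) x @[n --> \oo] --> nu `]-oo, x]%classic.
Arguments cvg_in_distribution [R d T] P Z nu.

(* Main.v *)
(* A c-SR is a path of an automaton, so the words of length n split uniquely
   into a first block (a prefix of c of length i-1 followed by a smaller digit)
   and a word of length n-i.  With y the inverse of the dominant root of the
   recurrence, the weights y^i of the blocks form a probability distribution q,
   and y^n times the sum of F(number of summands) over words of length n obeys a
   renewal equation with kernel q.

   X_{-n} corresponds to y^n modulo Z, and the value of an admissible word is in
   [0,1) and determines the word; hence c-SRs are unique and R_n is in bijection
   with the admissible words of length n ending in a nonzero digit.

   Solutions of the renewal equation with an exponentially small source term
   converge exponentially fast; applied to the first two centred moments this
   gives mean mu n + O(1) and variance sigma^2 n + O(1).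

   For the Gaussian limit we use Lindeberg's method: the function
   V(s,x) = Phi(x/sqrt s) solves the heat equation V_s = V_xx/2, so
   V(s0 + sigma^2 n, x) satisfies the renewal equation up to an error O(s0^(-3/2))
   per step.  By the maximum principle the smoothed distribution function, which
   starts from V(s0, .), stays close to V(s0 + sigma^2 n, .); taking
   s0 = d^2 n with d small removes the smoothing. *)
Require Import Defs.
From HB Require Import structures.
From mathcomp Require Import all_boot all_order all_algebra.
From mathcomp Require Import all_classical all_reals all_analysis.
From mathcomp Require Import ring lra zify.

Set Implicit Arguments.
Unset Strict Implicit.
Unset Printing Implicit Defensive.

Import Order.TTheory GRing.Theory Num.Theory.
Import numFieldNormedType.Exports.

Local Open Scope classical_set_scope.
Local Open Scope ring_scope.

(** * The normal distribution function and the heat equation *)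

Section gaussian.
Variable R : realType.
Implicit Types x y z u : R.

Lemma derive_bound (f df : R -> R) (a b B : R) :
  (forall x, is_derive x 1 f (df x)) ->
  (forall x, Num.min a b <= x <= Num.max a b -> `|df x| <= B) ->
  `|f b - f a| <= B * `|b - a|.
Proof.
move=> fdf; wlog ab : a b / a <= b => [H|] dfB.
  have [ab|/ltW ba] := leP a b; first exact: H.
  by rewrite distrC (distrC b); apply: H => // x; rewrite minC maxC; exact: dfB.
have [c cab E] : exists2 c : R, c \in `[a, b]%R & f b - f a = df c * (b - a).
  apply: MVT_segment => //.
  apply: continuous_subspaceT => x; apply: differentiable_continuous.
  by apply/derivable1_diffP; apply: ex_derive.
rewrite E normrM ler_wpM2r//; apply: dfB; rewrite (min_idPl ab) (max_idPr ab).
by move: cab; rewrite in_itv.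
Qed.

(** Each application trades one derivative for one more order of vanishing at 0; iterating it bounds
    Taylor remainders. The factor 1/(m+1) of an exact integration is given up. *)
Lemma derive_bound0 (f df : R -> R) (m : nat) (B t : R) :
  (forall x, is_derive x 1 f (df x)) -> f 0 = 0 ->
  0 <= B -> (forall x, `|df x| <= B * `|x| ^+ m) ->
  `|f t| <= B * `|t| ^+ m.+1.
Proof.
move=> fdf f0 B0 dfB.
have := @derive_bound f df 0 t (B * `|t| ^+ m) fdf.
rewrite f0 !subr0 exprSr mulrA; apply=> x xt.
apply: (le_trans (dfB x)); rewrite ler_wpM2l// lerXn2r ?nnegrE//.
move: xt; have [t0|/ltW t0] := leP 0 t => /andP[x0 xt].
  by rewrite !ger0_norm.
by rewrite !ler0_norm ?lerN2.
Qed.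

Definition phi z : R := normal_pdf 0 1 z.
Definition Phi z : R := fine (normal_prob 0 1 `]-oo, z]).

Lemma PhiE z : (Phi z)%:E = normal_prob 0 1 `]-oo, z].
Proof. by rewrite /Phi fineK// fin_num_measure. Qed.

Lemma Phi_ge0 z : 0 <= Phi z.
Proof. by rewrite -lee_fin PhiE. Qed.

Lemma Phi_le1 z : Phi z <= 1.
Proof. by rewrite -lee_fin PhiE probability_le1. Qed.

(** The identity, viewed as a random variable under the normal law, has [Phi] as its distribution
    function; the general limits of a cdf at both infinities then apply. *)
Let idTR : measurableTypeR R -> R := idfun.

#[local] HB.instance Definition _ :=
  @isMeasurableFun.Build _ _ _ _ idTR (@measurable_id _ _ setT).

Lemma Phi_tails (e : R) : 0 < e -> exists2 A : R, 0 < A &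
  (forall x, A <= x -> 1 - e <= Phi x) /\ (forall x, x <= - A -> Phi x <= e).
Proof.
move=> e0.
pose X : {RV (@normal_prob R 0 1 : probability (measurableTypeR R) R) >-> R} :=
  idTR.
have cN : (Phi x @[x --> -oo%R] --> (0 : R)).
  exact: (fine_cvg (@cvg_cdfNy0 _ _ R _ X)).
have cy : (Phi x @[x --> +oo%R] --> (1 : R)).
  exact: (fine_cvg (@cvg_cdfy1 _ _ R _ X)).
move/cvgrPdist_le : cN => /(_ _ e0) [a [_ ha]].
move/cvgrPdist_le : cy => /(_ _ e0) [b [_ hb]].
(* The neighbourhoods of infinity are the strict half-lines [x < a] and [b < x], hence the [+ 1];
   the entry 1 makes [A] positive. *)
exists (Num.max 1 (Num.max (- a + 1) (b + 1))); first by rewrite lt_max ltr01.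
split=> x; rewrite 1?lerNr !ge_max.
  move=> /and3P[_ _ bx].
  have /hb : b < x by lra.
  by rewrite ler_norml => /andP[_ ?]; lra.
move=> /and3P[_ ax _]; have /ha : x < a by lra.
by rewrite ler_norml => /andP[? _]; lra.
Qed.

Lemma phiE z : phi z = normal_peak 1 * expR (- z ^+ 2 / 2).
Proof. by rewrite /phi normal_pdfE ?oner_eq0// /normal_fun subr0 expr1n. Qed.

Lemma is_derive_phi z : is_derive z 1 phi (- (z * phi z)).
Proof.
have -> : phi = (normal_peak 1) \*: (expR \o ((-2^-1 : R) \*: ((@id R) ^+ 2))).
  apply/funext => x; rewrite phiE /GRing.scale/=; congr (_ * expR _).
  by rewrite /GRing.scale/= exprfctE; lra.
apply: is_derive_eq; rewrite /GRing.scale/= exprfctE.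
rewrite expr1 /GRing.scale/=.
by field.
Qed.

Lemma is_derive_idphi z :
  is_derive z 1 (fun u => u * phi u) ((1 - z ^+ 2) * phi z).
Proof.
have ? := is_derive_phi z.
have -> : (fun u => u * phi u) = (@id R) * phi by [].
by apply: is_derive_eq; rewrite /GRing.scale/=; ring.
Qed.

Lemma is_derive_Phi z : is_derive z 1 Phi (phi z).
Proof.
have zz : z < z + 1 by rewrite ltrDl.
have I : (@lebesgue_measure R).-integrable `]-oo, (z + 1)] (EFin \o phi).
  apply: integrableS (integrable_normal_pdf 0 1) => //.
have C : {for z, continuous phi}.
  by apply: continuous_normal_pdf; exact: oner_neq0.
have [] := continuous_FTC1 zz I (ltNyr z) C.
have -> : (fun x => (\int[lebesgue_measure]_(t in `]-oo, x]) phi t)%R) = Phi.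
  by apply/funext => x.
rewrite derive1E => dP <-.
exact: derivableP.
Qed.

Definition Cphi : R := 8 * normal_peak 1.

Lemma Cphi_ge0 : 0 <= Cphi.
Proof. by rewrite mulr_ge0 ?normal_peak_ge0. Qed.

Lemma phi_ge0 z : 0 <= phi z.
Proof. exact: normal_pdf_ge0. Qed.

(** For v >= 0 and j <= 4, v^j <= 1 + v^4, and the quadratic truncation of the exponential gives 1 +
    v^4/8 <= exp(v^2/2); this is where the 8 in [Cphi] comes from. *)
Lemma phi_moment j u : (j <= 4)%N -> `|u| ^+ j * phi u <= Cphi.
Proof.
move=> j4; rewrite phiE mulrCA /Cphi mulrC ler_wpM2r ?normal_peak_ge0//.
suff key (v : R) : 0 <= v -> v ^+ j <= 8 * expR (v ^+ 2 / 2).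
  rewrite -[u ^+ 2]real_normK ?num_real// mulNr expRN.
  by rewrite ler_pdivrMr ?expR_gt0// key.
move=> v0; have v1 : v ^+ j <= 1 + v ^+ 4.
  have [v1|v1] := leP v 1.
    by rewrite (le_trans (exprn_ile1 _ v0 v1))// lerDl exprn_ge0.
  by rewrite (le_trans (ler_weXn2l (ltW v1) j4))// lerDr.
have : 1 + (v ^+ 2 / 2) ^+ 2 / 2`!%:R <= expR (v ^+ 2 / 2).
  by apply: expR_ge1Dxn; rewrite divr_ge0// exprn_ge0.
have -> : (v ^+ 2 / 2) ^+ 2 / 2`!%:R = v ^+ 4 / 8 by rewrite (_ : 2`! = 2%N)//; field.
move: v1; have := exprn_ge0 4 v0; lra.
Qed.

Lemma norm_phi_moment j u : (j <= 4)%N -> `|u ^+ j * phi u| <= Cphi.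
Proof. by rewrite normrM normrX (ger0_norm (phi_ge0 _)); exact: phi_moment. Qed.

Lemma Phi_lipschitz x y : `|Phi x - Phi y| <= Cphi * `|x - y|.
Proof.
apply: derive_bound is_derive_Phi _ => u _.
by have := @norm_phi_moment 0 u isT; rewrite expr0 mul1r.
Qed.

Lemma idphi_lipschitz x y :
  `|x * phi x - y * phi y| <= 2 * Cphi * `|x - y|.
Proof.
apply: derive_bound is_derive_idphi _ => u _.
rewrite mulrBl mul1r (le_trans (ler_normB _ _))//.
have := @norm_phi_moment 0 u isT; have := @norm_phi_moment 2 u isT.
by rewrite expr0 mul1r; lra.
Qed.

(** The remainder [f0] and its derivative [f1] vanish at 0, and the second derivative [f2] is O(|x|)
    because u phi(u) is Lipschitz; two integrations give the cube. *)
Lemma Phi_taylor3 z t :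
  `|Phi (z + t) - Phi z - t * phi z + t ^+ 2 / 2 * (z * phi z)|
    <= 2 * Cphi * `|t| ^+ 3.
Proof.
have C2 : 0 <= 2 * Cphi by rewrite mulr_ge0// Cphi_ge0.
have dS (f : R -> R) (df x : R) : is_derive (z + x) 1 f df ->
    is_derive x 1 (f \o (cst z + id)) df.
  move=> h; rewrite -[df]mulr1; apply: is_derive1_comp => //.
  by apply: is_derive_eq; rewrite add0r.
pose f1 := (phi \o (cst z + id)) + cst (- phi z) + ((z * phi z) \*: (@id R)).
have f1E x : f1 x = phi (z + x) - phi z + x * (z * phi z).
  by rewrite /f1 /GRing.scale/= [x * _]mulrC.
pose f0 := (Phi \o (cst z + id)) + cst (- Phi z) + ((- phi z) \*: (@id R))
           + ((z * phi z / 2) \*: ((@id R) ^+ 2)).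
have f0E x : f0 x = Phi (z + x) - Phi z - x * phi z + x ^+ 2 / 2 * (z * phi z).
  by rewrite /f0 !fctE/= /GRing.scale/=; field.
pose f2 x := z * phi z - (z + x) * phi (z + x).
have d0 x : is_derive x 1 f0 (f1 x).
  have ? := dS _ _ x (is_derive_Phi (z + x)).
  by apply: is_derive_eq; rewrite f1E /GRing.scale/=; field.
have d1 x : is_derive x 1 f1 (f2 x).
  have ? := dS _ _ x (is_derive_phi (z + x)).
  by apply: is_derive_eq; rewrite /f2 /GRing.scale/=; ring.
rewrite -f0E; apply: (derive_bound0 (df := f1)) => //.
  by rewrite f0E addr0; ring.
move=> x; apply: (derive_bound0 (df := f2)) => //.
  by rewrite f1E addr0; ring.
move=> u; rewrite expr1 /f2; apply: le_trans (idphi_lipschitz _ _) _.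
by rewrite opprD addNKr normrN.
Qed.

(** First-order expansion of l |-> Phi(l z) at l = 1, uniform in z: for y >= 1 the second derivative
    at y is at most |yz|^3 phi(yz) in absolute value, a bounded moment. *)
Lemma Phi_scale z (l : R) : 1 <= l ->
  `|Phi (l * z) - Phi z - (l - 1) * (z * phi z)| <= Cphi * (l - 1) ^+ 2.
Proof.
move=> l1.
have dS (f : R -> R) (df x : R) : is_derive (x * z) 1 f df ->
    is_derive x 1 (f \o (z \*: (@id R))) (df * z).
  rewrite mulrC => h; apply: is_derive1_comp => //.
  by apply: is_derive_eq; rewrite /GRing.scale/= mulr1.
pose f0 := (Phi \o (z \*: (@id R))) + (- (z * phi z)) \*: (@id R).
have f0E x : f0 x = Phi (x * z) - x * (z * phi z).
  by rewrite /f0 !fctE/= /GRing.scale/= (mulrC z x) mulNr (mulrC x (z * _)).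
pose f1 := z \*: (phi \o (z \*: (@id R))) + cst (- (z * phi z)).
have f1E x : f1 x = z * phi (x * z) - z * phi z.
  by rewrite /f1 !fctE/= /GRing.scale/= [z * x]mulrC.
have d0 x : is_derive x 1 f0 (f1 x).
  have ? := dS _ _ x (is_derive_Phi (x * z)).
  by apply: is_derive_eq; rewrite f1E /GRing.scale/=; ring.
pose f2 x := - ((x * z) * phi (x * z) * z ^+ 2).
have d1 x : is_derive x 1 f1 (f2 x).
  have ? := dS _ _ x (is_derive_phi (x * z)).
  by apply: is_derive_eq; rewrite /f2 /GRing.scale/=; ring.
have E : Phi (l * z) - Phi z - (l - 1) * (z * phi z) = f0 l - f0 1.
  by rewrite !f0E !mul1r; ring.
have l10 : 0 <= l - 1 by rewrite subr_ge0.
have n1 : `|l - 1| = l - 1 by rewrite ger0_norm.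
rewrite E (le_trans (derive_bound (B := Cphi * (l - 1)) d0 _))//; last first.
  by rewrite n1 -mulrA -expr2.
rewrite (min_idPl l1) (max_idPr l1) => x /andP[x1 xl].
have -> : f1 x = f1 x - f1 1 by rewrite (f1E 1) mul1r subrr subr0.
rewrite (le_trans (derive_bound (B := Cphi) d1 _))//; last first.
  by rewrite ger0_norm ?subr_ge0// ler_wpM2l ?Cphi_ge0// lerD2r.
rewrite (min_idPl x1) (max_idPr x1) => y /andP[y1 _].
have := @norm_phi_moment 3 (y * z) isT.
rewrite /f2 normrN; apply: le_trans.
rewrite (_ : (y * z) ^+ 3 * _ = y ^+ 2 * ((y * z) * phi (y * z) * z ^+ 2)); last ring.
by rewrite [leRHS]normrM ler_peMl// ger0_norm ?sqr_ge0// exprn_ege1.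
Qed.
(** The distribution function of N(0, s), which solves V_s = V_xx/2. *)
Definition heat (s x : R) : R := Phi (x / Num.sqrt s).

(** Taylor expansion in parabolic scaling: space steps of size e sqrt(s), time steps of size e^2 s.
    By the heat equation xi^2 and -h share the coefficient V_xx/2, so the explicit terms average to
    0 as soon as xi has mean 0 and xi^2 has the mean of h. *)
Lemma heat_step (s h x xi e : R) : 0 < s -> 0 <= e <= 2^-1 ->
  `|xi| <= e * Num.sqrt s -> 0 <= h <= e ^+ 2 * s ->
  `|heat (s - h) (x + xi) - heat s x
    - xi * (phi (x / Num.sqrt s) / Num.sqrt s)
    + (xi ^+ 2 - h) * (x / Num.sqrt s * phi (x / Num.sqrt s) / (2 * s))|
  <= 5 * Cphi * e ^+ 3.
Proof.
move=> s0 /andP[e0 e1] xie /andP[h0 he].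
have r0 : 0 < Num.sqrt s by rewrite sqrtr_gt0.
have r2 : Num.sqrt s ^+ 2 = s by rewrite sqr_sqrtr// ltW.
set z := x / _; pose w := z + xi / Num.sqrt s.
pose eta := xi / Num.sqrt s; pose tau := h / s.
have tau0 : 0 <= tau by rewrite divr_ge0// ltW.
have taue : tau <= e ^+ 2 by rewrite ler_pdivrMr.
have ee2 : e ^+ 2 <= 4^-1 by nra.
have etae : `|eta| <= e.
  by rewrite normrM normfV (ger0_norm (ltW r0)) ler_pdivrMr.
have tau1 : 0 < 1 - tau by lra.
(* After normalising by sqrt(s), lowering the variance from s to s - h multiplies the argument of
   [Phi] by [l], and l - 1 is tau/2 up to tau^2. *)
pose l := (Num.sqrt (1 - tau))^-1.
have l0 : 0 < l by rewrite invr_gt0 sqrtr_gt0.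
have l2 : l ^+ 2 * (1 - tau) = 1.
  by rewrite exprVn sqr_sqrtr ?ltW// mulVf// gt_eqF.
have l1 : 1 <= l by nra.
have ltau : l - 1 <= tau.
  rewrite lerBlDr addrC -ler_sqr ?nnegrE ?addr_ge0 ?(ltW l0)//.
  rewrite -(ler_pM2r tau1) l2; have : tau <= 4^-1 by lra.
  nra.
have tauE : tau = (l ^+ 2 - 1) / l ^+ 2.
  apply: (mulIf (x := l ^+ 2)); first by rewrite gt_eqF ?exprn_gt0.
  by rewrite divfK ?gt_eqF ?exprn_gt0//; lra.
have lb : `|l - 1 - tau / 2| <= tau ^+ 2.
  have -> : l - 1 - tau / 2 = tau * ((l - 1) * ((2 * l + 1) / (2 * (l + 1)))).
    by rewrite tauE; field; rewrite !gt_eqF//; lra.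
  have m0 : 0 <= (2 * l + 1) / (2 * (l + 1)) by rewrite divr_ge0//; lra.
  have m1 : (2 * l + 1) / (2 * (l + 1)) <= 1 by rewrite ler_pdivrMr; lra.
  move: m0 m1; set m := _ / _ => m0 m1.
  have lm : (l - 1) * m <= tau by nra.
  have lm0 : 0 <= (l - 1) * m by rewrite mulr_ge0// subr_ge0.
  by rewrite (ger0_norm (mulr_ge0 tau0 lm0)) expr2 ler_wpM2l.
have E1 : heat (s - h) (x + xi) = Phi (l * w).
  rewrite /heat /l /w /z -mulrDl; congr Phi.
  have -> : s - h = s * (1 - tau) by rewrite /tau; field; rewrite gt_eqF.
  by rewrite sqrtrM ?ltW// invfM; ring.
have E2 : xi * (phi z / Num.sqrt s) = eta * phi z by rewrite /eta; ring.
have E3 : (xi ^+ 2 - h) * (z * phi z / (2 * s)) =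
          (eta ^+ 2 - tau) / 2 * (z * phi z).
  by rewrite expr_div_n r2 /tau; field; rewrite gt_eqF.
rewrite E1 E2 E3 /heat -/z.
have B1 := Phi_scale w l1.
have B2 := Phi_taylor3 z eta.
have B3 := idphi_lipschitz w z.
have B4 := @norm_phi_moment 1 w isT.
have C0 := Cphi_ge0.
have E4 : w - z = eta by rewrite /w /eta; ring.
(* Four errors: the rescaling by [l], the replacement of l - 1 by tau/2, the move from [w] to [z],
   and the Taylor remainder in [eta]. They cost 1, 1, 1 and 2 times Cphi e^3. *)
have -> : Phi (l * w) - Phi z - eta * phi z + (eta ^+ 2 - tau) / 2 * (z * phi z)
  = (Phi (l * w) - Phi w - (l - 1) * (w * phi w))
  + (l - 1 - tau / 2) * (w * phi w) + tau / 2 * (w * phi w - z * phi z)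
  + (Phi (z + eta) - Phi z - eta * phi z + eta ^+ 2 / 2 * (z * phi z)).
  by rewrite (_ : z + eta = w)//; field.
have T1 : tau ^+ 2 <= e ^+ 3 by nra.
have T2 : (l - 1) ^+ 2 <= e ^+ 3 by nra.
have T3 : `|eta| ^+ 3 <= e ^+ 3 by rewrite lerXn2r ?nnegrE.
have T4 : tau * `|eta| <= e ^+ 3 by rewrite exprSr ler_pM.
rewrite expr1 in B4; rewrite E4 in B3.
have U1 : `|(l - 1 - tau / 2) * (w * phi w)| <= e ^+ 3 * Cphi.
  by rewrite normrM ler_pM// (le_trans lb).
have U2 : `|tau / 2 * (w * phi w - z * phi z)| <= e ^+ 3 * Cphi.
  have t20 : 0 <= tau / 2 by lra.
  rewrite normrM (ger0_norm t20); apply: (le_trans (ler_wpM2l t20 B3)).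
  rewrite (_ : tau / 2 * _ = tau * `|eta| * Cphi); last by field.
  by rewrite ler_wpM2r.
have U3 := ler_wpM2l C0 T2.
have U4 := ler_wpM2l C0 T3.
rewrite (le_trans (ler_normD _ _))// (le_trans (lerD (ler_normD _ _) (lexx _)))//.
rewrite (le_trans (lerD (lerD (ler_normD _ _) (lexx _)) (lexx _)))//.
lra.
Qed.

(** The crude form of [heat_step]: its linear and quadratic terms are each at most e times [Cphi],
    whence 7 = 5 + 1 + 1. *)
Lemma heat_step0 (s h x xi e : R) : 0 < s -> 0 <= e <= 2^-1 ->
  `|xi| <= e * Num.sqrt s -> 0 <= h <= e ^+ 2 * s ->
  `|heat (s - h) (x + xi) - heat s x| <= 7 * Cphi * e.
Proof.
move=> s0 e01 xie he; have := heat_step x s0 e01 xie he.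
set a := _ - heat s x; set b := xi * _; set d := _ * (_ / _).
have r0 : 0 < Num.sqrt s by rewrite sqrtr_gt0.
have C0 := Cphi_ge0.
have bB : `|b| <= e * Cphi.
  rewrite /b mulrCA mulrC normrM ler_pM//.
    by rewrite normrM normfV (gtr0_norm r0) ler_pdivrMr.
  by have := @norm_phi_moment 0 (x / Num.sqrt s) isT; rewrite expr0 mul1r.
have dB : `|d| <= e * Cphi.
  have -> : d = (xi ^+ 2 - h) / s / 2 *
      (x / Num.sqrt s * phi (x / Num.sqrt s)).
    by rewrite /d; field; rewrite !gt_eqF.
  rewrite normrM ler_pM//; last first.
    by have := @norm_phi_moment 1 (x / Num.sqrt s) isT; rewrite expr1.
  have xs : xi ^+ 2 / s <= e ^+ 2.
    rewrite ler_pdivrMr// -[s in leRHS]sqr_sqrtr ?(ltW s0)// -exprMn.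
    rewrite -[xi ^+ 2]real_normK ?num_real// lerXn2r ?nnegrE//.
    by rewrite mulr_ge0 ?(ltW r0)//; case/andP: e01.
  have hs : h / s <= e ^+ 2 by rewrite ler_pdivrMr//; lra.
  have xs0 : 0 <= xi ^+ 2 / s by rewrite divr_ge0 ?sqr_ge0// ltW.
  have hs0 : 0 <= h / s by case/andP: he => h0 _; rewrite divr_ge0 ?(ltW s0).
  case/andP: e01 => *; have e2 : e ^+ 2 <= e by nra.
  by rewrite ler_norml mulrBl; lra.
have e3 : e ^+ 3 <= e by case/andP: e01 => *; nra.
have := ler_wpM2l C0 e3.
move=> Ce; have : a = (a - b + d) + b - d by ring.
set t := a - b + d => -> tB.
have := ler_normB (t + b) d; have := ler_normD t b.
lra.
Qed.

Lemma heat_ge0 s x : 0 <= heat s x. Proof. exact: Phi_ge0. Qed.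
Lemma heat_le1 s x : heat s x <= 1. Proof. exact: Phi_le1. Qed.
End gaussian.
(** * Renewal equations with finitely many blocks *)

Ltac nneg := repeat first [assumption | exact: ler0n | exact: normr_ge0
  | exact: sqr_ge0 | by apply: ltW | apply: addr_ge0 | apply: mulr_ge0
  | rewrite invr_ge0 | apply: exprn_ge0
  | by apply: sumr_ge0 => *; nneg | lra].

Ltac nlia := repeat match goal with
  | H : is_true (Order.le _ _) |- _ => clear H
  | H : is_true (Order.lt _ _) |- _ => clear H
  | H : @eq (Real.sort _) _ _ |- _ => clear H
  end; lia.

Section renewal.
Variable R : realType.

(** With [D n] the sum of the remaining increments' bounds, the intervals of centre [x n] and radius
    [D n] are nested; the limit is the supremum of their left ends. *)
Lemma geometric_cvg (x : nat -> R) (C th : R) : 0 <= C -> 0 < th < 1 ->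
  (forall n, (0 < n)%N -> `|x n.+1 - x n| <= C * th ^+ n) ->
  exists l, forall n, (0 < n)%N -> `|x n - l| <= C / (1 - th) * th ^+ n.
Proof.
move=> C0 /andP[th0 th1] xC.
have t1 : 0 < 1 - th by rewrite subr_gt0.
pose D n := C / (1 - th) * th ^+ n.
have D0 n : 0 <= D n by rewrite mulr_ge0 ?divr_ge0 ?exprn_ge0 ?(ltW t1) ?(ltW th0).
have DS n : D n = C * th ^+ n + D n.+1.
  by rewrite /D exprS; field; rewrite gt_eqF.
have step m n : (0 < m)%N -> x m - D m <= x (m + n)%N - D (m + n)%N /\
    x (m + n)%N + D (m + n)%N <= x m + D m.
  move=> m0; elim: n => [|n [IH1 IH2]]; first by rewrite addn0.
  have := xC (m + n)%N; rewrite addn_gt0 m0 => /(_ isT).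
  have := DS (m + n)%N; rewrite addnS ler_norml => e /andP[? ?].
  by split; lra.
have ab m n : (0 < m)%N -> (0 < n)%N -> x m - D m <= x n + D n.
  move=> m0 n0; have [mn|nm] := leqP m n.
    have := (step m (n - m)%N m0).1; rewrite subnKC//; have := D0 n; lra.
  have := (step n (m - n)%N n0).2; rewrite subnKC ?(ltnW nm)//; have := D0 m; lra.
pose A := [set x m - D m | m in [set m | (0 < m)%N]].
have A0 : A !=set0 by exists (x 1%N - D 1%N); exists 1%N.
have Aub n : (0 < n)%N -> ubound A (x n + D n).
  by move=> n0 _ [m m0 <-]; exact: ab.
exists (sup A) => n n0; rewrite ler_norml -/(D n).
have h1 : sup A <= x n + D n by apply: ge_sup => //; exact: Aub.
have h2 : x n - D n <= sup A.
  by apply: ub_le_sup; [exists (x 1%N + D 1%N); exact: Aub|exists n].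
by apply/andP; split; lra.
Qed.

Lemma bernoulli_ineq (u : R) n : 0 <= u <= 1 -> 1 - n%:R * u <= (1 - u) ^+ n.
Proof.
move=> /andP[u0 u1]; elim: n => [|n IH]; first by rewrite mul0r subr0.
rewrite exprS; apply: (le_trans _ (ler_wpM2l _ IH)); last by rewrite subr_ge0.
have h : 0 <= n%:R * u * u :> R by rewrite !mulr_ge0.
by rewrite -natr1; lra.
Qed.

(** A block [b] has length [b.1] and digit sum [b.2]. The weights y^(b.1) form the renewal kernel,
    which charges every length from 1 to k. *)
Variables (bl : seq (nat * nat)) (k : nat) (y : R).
Hypothesis y01 : 0 < y < 1.
Hypothesis k0 : (0 < k)%N.
Hypothesis bl_len : {in bl, forall b, (0 < b.1 <= k)%N}.
Hypothesis bl_all : forall j, (0 < j <= k)%N -> exists2 b, b \in bl & b.1 = j.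

Notation q b := (y ^+ b.1).
Hypothesis q_sum : \sum_(b <- bl) q b = 1.

Let y0 : 0 < y. Proof. by case/andP: y01. Qed.
Let y1 : y <= 1. Proof. by case/andP: y01 => _ /ltW. Qed.
Let q0 (b : nat * nat) : 0 <= q b. Proof. by rewrite exprn_ge0 ?(ltW y0). Qed.

Lemma sum_q_le (F : nat * nat -> R) (B : R) :
  {in bl, forall b, F b <= B} -> \sum_(b <- bl) q b * F b <= B.
Proof.
move=> FB; rewrite -[B in leRHS]mul1r -q_sum mulr_suml big_seq [leRHS]big_seq.
by apply: ler_sum => b bbl; rewrite ler_wpM2l ?FB.
Qed.

Lemma norm_sum_q (F : nat * nat -> R) (B : R) :
  {in bl, forall b, `|F b| <= B} -> `|\sum_(b <- bl) q b * F b| <= B.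
Proof.
move=> FB; apply: (le_trans (ler_norm_sum _ _ _)).
under eq_bigr do rewrite normrM (ger0_norm (q0 _)).
exact: sum_q_le.
Qed.

Definition defect (x : nat -> R) n := x n - \sum_(b <- bl) q b * x (n - b.1)%N.

(* [x n - x (n - j)] is, up to the defect, the [q]-average of the differences
   [x (n - b.1) - x (n - j)]; the term with [b.1 = j] vanishes, which gives
   the contraction factor [1 - y ^+ k]. *)
Lemma defect_contraction : exists2 th : R, 0 < th < 1 &
  forall (x : nat -> R) (E : R), (forall n, (k < n)%N -> `|defect x n| <= E * th ^+ n) ->
  exists l C, [/\ 0 <= C & forall n, (0 < n)%N -> `|x n - l| <= C * th ^+ n].
Proof.
pose d := y ^+ k.
have d0 : 0 < d by rewrite exprn_gt0.
have d1 : d <= 1 by rewrite exprn_ile1 ?(ltW y0).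
have kR : 1 <= k%:R :> R by rewrite ler1n.
(* Chosen so that Bernoulli's inequality gives th^k >= 1 - d/2, strictly above the contraction
   factor 1 - d. *)
pose u := d / (2 * k%:R).
have u0 : 0 < u by rewrite divr_gt0//; lra.
have u1 : u <= 2^-1 by rewrite ler_pdivrMr; nra.
pose th := 1 - u; have th0 : 0 < th by rewrite /th; lra.
have th1 : th < 1 by rewrite /th; lra.
have thk : 1 - d / 2 <= th ^+ k.
  have := @bernoulli_ineq u k; rewrite (_ : k%:R * u = d / 2); first by apply; lra.
  by rewrite /u; field; rewrite pnatr_eq0; nlia.
exists th; first by rewrite th0.
move=> x E xE.
have E0 : 0 <= E.
  have := le_trans (normr_ge0 _) (xE k.+1 (leqnn _)).
  by rewrite pmulr_lge0// exprn_gt0.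
pose C0 := \sum_(n < k.+1) \sum_(m < k.+1) `|x n - x m|.
pose C := C0 / th ^+ k + 2 * E / d.
have C0ge : 0 <= C0 by rewrite sumr_ge0// => i _; rewrite sumr_ge0.
have Cge : 0 <= C by rewrite /C; nneg.
(* Strong induction on the oscillation over a window of length k. In [C], the first term covers the
   indices up to k and the second absorbs the source. *)
have osc n : (0 < n)%N -> forall m, (0 < m < n)%N -> (n <= m + k)%N ->
    `|x n - x m| <= C * th ^+ n.
  elim/ltn_ind: n => n IH n0 m /andP[m0 mn] nmk.
  have [nk|kn] := leqP n k.
    have h1 : `|x n - x m| <= C0.
      rewrite /C0 (bigD1 (inord n))//= (bigD1 (inord m))//= !inordK ?ltnS//; last by exact: leq_trans (ltnW mn) nk.
      by rewrite -addrA lerDl addr_ge0// ?sumr_ge0// => i _; rewrite ?sumr_ge0.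
    apply: (le_trans h1); apply: (@le_trans _ _ (C0 / th ^+ k * th ^+ n)).
      rewrite -mulrA ler_peMr// mulrC ler_pdivlMr ?exprn_gt0// mul1r.
      by rewrite ler_wiXn2l ?(ltW th0) ?(ltW th1).
    rewrite ler_wpM2r ?exprn_ge0 ?(ltW th0)// lerDl.
    by rewrite divr_ge0 ?(ltW d0)// mulr_ge0.
  have xnm : x n - x m = defect x n + \sum_(b <- bl) q b * (x (n - b.1)%N - x m).
    under eq_bigr do rewrite mulrBr.
    by rewrite sumrB -mulr_suml q_sum mul1r /defect; ring.
  pose B := C * th ^+ (n - k).
  have B0 : 0 <= B by rewrite mulr_ge0// exprn_ge0// ltW.
  have wk p : (n - k <= p)%N -> C * th ^+ p <= B.
    by move=> np; rewrite ler_wpM2l// ler_wiXn2l ?(ltW th0) ?(ltW th1).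
  have Gi (i : nat) : (0 < i)%N -> (i <= k)%N -> `|x (n - i)%N - x m| <= B.
    move=> i0 ik.
    have pn : (n - i < n)%N by nlia.
    have p0 : (0 < n - i)%N by nlia.
    case: (ltngtP (n - i)%N m) => [pm|mp|->]; last by rewrite subrr normr0.
      have h := IH m mn m0 (n - i)%N.
      by rewrite distrC (le_trans (h _ _))// ?wk// ?p0//; nlia.
    have h := IH (n - i)%N pn p0 m.
    by rewrite (le_trans (h _ _))// ?wk// ?m0//; nlia.
  have GB b : b \in bl -> `|x (n - b.1)%N - x m| <= B.
    by move=> /bl_len /andP[b0 bk]; exact: Gi.
  have [|b0 b0bl b0E] := bl_all (j := (n - m)%N); first by nlia.
  have sB : `|\sum_(b <- bl) q b * (x (n - b.1)%N - x m)| <= (1 - d) * B.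
    rewrite (big_rem b0)//= b0E subKn ?(ltnW mn)// subrr mulr0 add0r.
    apply: (le_trans (ler_norm_sum _ _ _)).
    apply: (@le_trans _ _ ((1 - q b0) * B)); last first.
      by rewrite ler_wpM2r// lerB// ler_wiXn2l ?(ltW y0)// b0E; nlia.
    have -> : 1 - q b0 = \sum_(b <- rem b0 bl) q b.
      by rewrite -q_sum (big_rem b0)//=; ring.
    rewrite mulr_suml big_seq [leRHS]big_seq; apply: ler_sum => b /mem_rem bbl.
    by rewrite normrM (ger0_norm (q0 _)) ler_wpM2l// GB.
  rewrite xnm (le_trans (ler_normD _ _))//; apply: (le_trans (lerD (xE n kn) sB)).
  have thn : th ^+ n = th ^+ k * th ^+ (n - k) by rewrite -exprD subnKC// ltnW.
  (* Since th^k - (1 - d) >= d/2, the contraction leaves a margin of d/2 times [C], which has to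
     cover [E]. *)
  have Ed : E <= d / 2 * C.
    rewrite /C mulrDr (_ : d / 2 * (2 * E / d) = E); last first.
      by field; rewrite gt_eqF.
    by rewrite lerDr; nneg.
  have t0 : 0 <= th ^+ (n - k) by rewrite exprn_ge0// ltW.
  have tk0 : 0 <= th ^+ k by rewrite exprn_ge0// ltW.
  have tk1 : th ^+ k <= 1 by rewrite exprn_ile1// ltW.
  rewrite thn /B -subr_ge0 (_ : _ - _ =
    (C * (th ^+ k - (1 - d)) - E * th ^+ k) * th ^+ (n - k)); last by ring.
  rewrite mulr_ge0// subr_ge0 (@le_trans _ _ E)//; first by nra.
  by rewrite (le_trans Ed)// mulrC ler_wpM2l//; lra.
have Cth0 : 0 <= C * th by rewrite mulr_ge0// ltW.
have th01 : 0 < th < 1 by rewrite th0.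
have [n n0|l xl] := geometric_cvg Cth0 th01 (x := x).
  by rewrite -mulrA -exprS; apply: osc => //; nlia.
exists l, (C * th / (1 - th)); split => //.
by rewrite divr_ge0// subr_ge0 ltW.
Qed.

(** * Tilted sums over words, their mass, drift and variance *)

Variable L : nat -> seq nat.
(** In the application [L n] lists the digit sums of the words of length n, and this is the removal
    of the first block. For k < n the remaining word is never empty. *)
Hypothesis L_rec : forall n (F : nat -> R), (k < n)%N ->
  \sum_(w <- L n) F w = \sum_(b <- bl) \sum_(w <- L (n - b.1)%N) F (b.2 + w)%N.
Hypothesis L_neq0 : forall n, (0 < n)%N -> (0 < size (L n))%N.
Hypothesis bl_pos : has (fun b => 0 < b.2)%N bl.
Hypothesis bl_unit : (1, 0)%N \in bl.

(** The factor y^n splits over the first block and the rest, which turns [L_rec] into an average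
    against the probability kernel. *)
Definition tilt n (F : nat -> R) : R := y ^+ n * \sum_(w <- L n) F w.

Lemma tilt_rec n F : (k < n)%N ->
  tilt n F = \sum_(b <- bl) q b * tilt (n - b.1)%N (fun w => F (b.2 + w)%N).
Proof.
move=> kn; rewrite /tilt L_rec// mulr_sumr big_seq [RHS]big_seq.
apply: eq_bigr => b bbl; rewrite mulrA -exprD subnKC//.
by have /andP[_ bk] := bl_len bbl; rewrite (leq_trans bk)// ltnW.
Qed.

Lemma tiltD n F G : tilt n (fun w => F w + G w) = tilt n F + tilt n G.
Proof. by rewrite /tilt big_split mulrDr. Qed.

Lemma tiltZ n a F : tilt n (fun w => a * F w) = a * tilt n F.
Proof. by rewrite /tilt -mulr_sumr mulrCA. Qed.

Lemma eq_tilt n F G : F =1 G -> tilt n F = tilt n G.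
Proof. by move=> FG; congr (_ * _); apply: eq_bigr => w _; rewrite FG. Qed.

Lemma le_tilt n F G : (forall w, F w <= G w) -> tilt n F <= tilt n G.
Proof.
by move=> FG; rewrite ler_wpM2l ?exprn_ge0 ?(ltW y0)//; apply: ler_sum.
Qed.

Definition mass n : R := tilt n (fun=> 1).

Lemma mass_rec n : (k < n)%N -> mass n = \sum_(b <- bl) q b * mass (n - b.1)%N.
Proof. exact: tilt_rec. Qed.

Lemma massE n : mass n = y ^+ n * (size (L n))%:R.
Proof. by rewrite /mass /tilt big_const_seq count_predT iter_addr_0. Qed.

(** A minimum principle: the bound holds for n <= k since [L n] is nonempty, and averaging preserves
    it. *)
Lemma mass_ge n : (0 < n)%N -> y ^+ k <= mass n.
Proof.
elim/ltn_ind: n => n IH n0; have [nk|kn] := leqP n k.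
  rewrite massE (@le_trans _ _ (y ^+ n))// ?ler_wiXn2l ?(ltW y0)//.
  by rewrite ler_peMr ?exprn_ge0 ?(ltW y0)// ler1n L_neq0.
rewrite mass_rec// -[leLHS]mul1r -q_sum mulr_suml big_seq [leRHS]big_seq.
apply: ler_sum => b bbl; have /andP[b0 bk] := bl_len bbl.
rewrite ler_wpM2l//; apply: IH.
  by rewrite ltn_subrL b0.
by rewrite subn_gt0 (leq_ltn_trans bk).
Qed.

Lemma mass_gt0 n : (0 < n)%N -> 0 < mass n.
Proof. by move=> n0; apply: lt_le_trans (mass_ge n0); rewrite exprn_gt0. Qed.

Definition mean_len : R := \sum_(b <- bl) q b * b.1%:R.
(** Renewal-reward constants: [mu] is the mean reward per unit length, [xi] the centred reward of a
    block, and [sigma2] the value for which xi^2 - sigma2 * length has mean 0 under the kernel. *)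
Definition mu : R := (\sum_(b <- bl) q b * b.2%:R) / mean_len.
Definition xi (b : nat * nat) : R := b.2%:R - mu * b.1%:R.
Definition sigma2 : R := (\sum_(b <- bl) q b * xi b ^+ 2) / mean_len.

Lemma mean_len_gt0 : 0 < mean_len.
Proof.
apply: (@lt_le_trans _ _ 1) => //.
rewrite /mean_len -[leLHS]q_sum big_seq [leRHS]big_seq; apply: ler_sum => b bbl.
by rewrite ler_peMr// ler1n; case/andP: (bl_len bbl).
Qed.

Lemma sum_q_xi : \sum_(b <- bl) q b * xi b = 0.
Proof.
under eq_bigr do rewrite mulrBr mulrCA.
by rewrite sumrB -mulr_sumr -/mean_len /mu divfK ?subrr// gt_eqF// mean_len_gt0.
Qed.

Lemma sum_q_xi2 : \sum_(b <- bl) q b * (xi b ^+ 2 - sigma2 * b.1%:R) = 0.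
Proof.
under eq_bigr do rewrite mulrBr [_ * (sigma2 * _)]mulrCA.
by rewrite sumrB -mulr_sumr -/mean_len /sigma2 divfK ?subrr// gt_eqF// mean_len_gt0.
Qed.

Lemma mu_gt0 : 0 < mu.
Proof.
rewrite divr_gt0 ?mean_len_gt0//; have /hasP[b bbl b2] := bl_pos.
rewrite (big_rem b)//= ltr_wpDr//; first by rewrite sumr_ge0// => *; rewrite mulr_ge0.
by rewrite mulr_gt0 ?exprn_gt0// ltr0n.
Qed.

(** The one-digit block 0 already has the nonzero centred reward - mu. *)
Lemma sigma2_gt0 : 0 < sigma2.
Proof.
rewrite divr_gt0 ?mean_len_gt0// (big_rem _ bl_unit)//= ltr_wpDr//.
  by rewrite sumr_ge0// => *; rewrite mulr_ge0// sqr_ge0.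
have -> : xi (1, 0)%N = - mu by rewrite /xi /= sub0r mulr1.
by rewrite sqrrN mulr_gt0 ?exprn_gt0 ?mu_gt0.
Qed.

(** * The first two centred moments *)

Definition dev1 n := tilt n (fun w => w%:R - mu * n%:R).
Definition dev2 n := tilt n (fun w => (w%:R - mu * n%:R) ^+ 2 - sigma2 * n%:R).

Lemma shiftE n (b : nat * nat) w : (b.1 <= n)%N ->
  (b.2 + w)%:R - mu * n%:R = (w%:R - mu * (n - b.1)%:R) + xi b.
Proof. by move=> bn; rewrite natrB// natrD /xi; ring. Qed.

Lemma bl_le n b : (k < n)%N -> b \in bl -> (b.1 <= n)%N.
Proof. by move=> kn /bl_len /andP[_ bk]; rewrite (leq_trans bk)// ltnW. Qed.

Lemma bl_gt n b : (k < n)%N -> b \in bl -> (0 < n - b.1)%N.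
Proof. by move=> kn /bl_len /andP[_ bk]; rewrite subn_gt0 (leq_ltn_trans bk). Qed.

(** The constant [kap] is free because [xi] averages to 0. Taking it to be the limit of [mass] makes
    the source exponentially small. *)
Lemma defect_dev1 n kap : (k < n)%N ->
  defect dev1 n = \sum_(b <- bl) q b * (xi b * (mass (n - b.1)%N - kap)).
Proof.
move=> kn; rewrite /defect {1}/dev1 tilt_rec// -sumrB.
transitivity (\sum_(b <- bl) (q b * (xi b * mass (n - b.1)%N) - q b * xi b * kap)).
  rewrite [RHS]sumrB -mulr_suml sum_q_xi mul0r subr0.
  rewrite big_seq [RHS]big_seq; apply: eq_bigr => b bbl.
  rewrite -mulrBr; congr (_ * _); rewrite /dev1 /mass -[in RHS]tiltZ.
  apply/eqP; rewrite subr_eq addrC -tiltD; apply/eqP/eq_tilt => w.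
  by rewrite shiftE ?mulr1// bl_le.
by apply: eq_bigr => b _; ring.
Qed.

(** Again [kap] and [d] are free, as both [xi] and xi^2 - sigma2 * length average to 0; they will be
    the limits of [mass] and [dev1]. *)
Lemma defect_dev2 n kap d : (k < n)%N ->
  defect dev2 n = \sum_(b <- bl) q b * (2 * xi b * (dev1 (n - b.1)%N - d)
    + (xi b ^+ 2 - sigma2 * b.1%:R) * (mass (n - b.1)%N - kap)).
Proof.
move=> kn; rewrite /defect {1}/dev2 tilt_rec// -sumrB.
transitivity (\sum_(b <- bl) (q b * (2 * xi b * dev1 (n - b.1)%N
    + (xi b ^+ 2 - sigma2 * b.1%:R) * mass (n - b.1)%N)
    - (q b * xi b * (2 * d) + q b * (xi b ^+ 2 - sigma2 * b.1%:R) * kap))).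
  rewrite [RHS]sumrB [X in _ = _ - X]big_split/= -!mulr_suml sum_q_xi sum_q_xi2.
  rewrite !mul0r addr0 subr0.
  rewrite big_seq [RHS]big_seq; apply: eq_bigr => b bbl.
  rewrite -mulrBr; congr (_ * _); rewrite /dev2 /dev1 /mass -!tiltZ.
  apply/eqP; rewrite subr_eq -!tiltD; apply/eqP/eq_tilt => w.
  have bn := bl_le kn bbl.
  by rewrite shiftE// natrB//; ring.
by apply: eq_bigr => b _; ring.
Qed.

Definition xi_bound : R := 1 + sigma2 * k%:R + \sum_(b <- bl) (`|xi b| + `|xi b| ^+ 2).

Lemma xi_bound_ge1 : 1 <= xi_bound.
Proof.
rewrite /xi_bound -addrA lerDl addr_ge0//.
  by rewrite mulr_ge0// ltW// sigma2_gt0.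
by rewrite sumr_ge0// => b _; rewrite addr_ge0// exprn_ge0.
Qed.

Lemma xi_le_bound b : b \in bl ->
  `|xi b| <= xi_bound /\ `|xi b ^+ 2 - sigma2 * b.1%:R| <= xi_bound.
Proof.
move=> bbl; have s0 := ltW sigma2_gt0; have /andP[_ bk] := bl_len bbl.
have sk : sigma2 * b.1%:R <= sigma2 * k%:R by rewrite ler_wpM2l// ler_nat.
have sb : 0 <= sigma2 * b.1%:R by rewrite mulr_ge0.
have h : `|xi b| + `|xi b| ^+ 2 <= \sum_(b <- bl) (`|xi b| + `|xi b| ^+ 2).
  by rewrite [leRHS](big_rem b)//= lerDl sumr_ge0// => *; rewrite addr_ge0// exprn_ge0.
have h0 := normr_ge0 (xi b); have h2 : 0 <= `|xi b| ^+ 2 by rewrite exprn_ge0.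
split; first by rewrite /xi_bound; lra.
rewrite -[xi b ^+ 2]real_normK ?num_real// ler_norml /xi_bound.
by apply/andP; split; lra.
Qed.

(** Three uses of [defect_contraction] with the same rate: [mass] has no defect and converges; hence
    the defect of [dev1] decays and [dev1] converges; hence the same for [dev2]. *)
Lemma moment_bounds : exists th kap C : R, [/\ 0 < th < 1, 0 <= C,
  forall n, (0 < n)%N -> `|mass n - kap| <= C * th ^+ n,
  forall n, (0 < n)%N -> `|dev1 n| <= C &
  forall n, (0 < n)%N -> `|dev2 n| <= C].
Proof.
have [th th01 contr] := defect_contraction; have /andP[th0 th1] := th01.
have X0 : 0 <= xi_bound by have := xi_bound_ge1; lra.
have pw n b C : (k < n)%N -> b \in bl -> 0 <= C ->
    C * th ^+ (n - b.1) <= C / th ^+ k * th ^+ n.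
  move=> kn bbl C0; rewrite -mulrA ler_wpM2l// mulrC ler_pdivlMr ?exprn_gt0//.
  rewrite -exprD ler_wiXn2l ?(ltW th0) ?(ltW th1)//.
  by have /andP[_] := bl_len bbl; move: (b.1) kn; clear; move=> *; lia.
have bd (x : nat -> R) l C n : 0 <= C -> (forall n, (0 < n)%N -> `|x n - l| <= C * th ^+ n) ->
    (0 < n)%N -> `|x n| <= `|l| + C.
  move=> C0 xl n0; rewrite -[x n](subrK l) addrC (le_trans (ler_normD _ _))//.
  by rewrite lerD2l (le_trans (xl n n0))// ler_piMr// exprn_ile1// ltW.
have [n kn|kap [C0 [C0ge C0E]]] := contr mass 0.
  by rewrite /defect mass_rec// subrr normr0 mul0r.
have [n kn|d1 [C1 [C1ge C1E]]] := contr dev1 (xi_bound * C0 / th ^+ k).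
  rewrite (defect_dev1 kap kn); apply: norm_sum_q => b bbl.
  apply: (@le_trans _ _ (xi_bound * C0 * th ^+ (n - b.1))).
    have [h _] := xi_le_bound bbl.
    by rewrite normrM -mulrA ler_pM// C0E// bl_gt.
  by apply: pw => //; rewrite mulr_ge0.
have [n kn|d2 [C2 [C2ge C2E]]] :=
    contr dev2 ((2 * xi_bound * C1 + xi_bound * C0) / th ^+ k).
  rewrite (defect_dev2 kap d1 kn); apply: norm_sum_q => b bbl.
  apply: (@le_trans _ _ ((2 * xi_bound * C1 + xi_bound * C0) * th ^+ (n - b.1))).
    have [h1 h2] := xi_le_bound bbl.
    rewrite (le_trans (ler_normD _ _))// [leRHS]mulrDl lerD//.
      rewrite normrM -[leRHS]mulrA ler_pM//; last by rewrite C1E// bl_gt.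
      by rewrite normrM normr_nat ler_wpM2l.
    by rewrite normrM -mulrA ler_pM// C0E// bl_gt.
  by apply: pw => //; rewrite addr_ge0 ?mulr_ge0.
exists th, kap, (C0 + (`|d1| + C1) + (`|d2| + C2)).
have a1 := normr_ge0 d1; have a2 := normr_ge0 d2.
split=> // [|n n0|n n0|n n0]; first by lra.
- by rewrite (le_trans (C0E n n0))// ler_wpM2r ?exprn_ge0 ?(ltW th0)//; lra.
- by rewrite (le_trans (bd _ _ _ _ C1ge C1E n0))//; lra.
- by rewrite (le_trans (bd _ _ _ _ C2ge C2E n0))//; lra.
Qed.

Lemma sum_geometric (th : R) n : 0 < th < 1 ->
  \sum_(j < n) th ^+ j <= (1 - th)^-1.
Proof.
move=> /andP[th0 th1]; have t : 0 < 1 - th by rewrite subr_gt0.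
rewrite -[leRHS]mul1r ler_pdivlMr// mulrC -opprB mulNr -subrX1 opprB.
by rewrite lerBlDr lerDl exprn_ge0// ltW.
Qed.

(** * Lindeberg comparison with the heat equation *)

(** An average does not exceed the largest bound on its terms. Every term has index below n, so its
    accumulated error stops before [eta n], and one step adds only that error. *)
Lemma maximum_principle (G : nat -> R -> R) (A : R) (eta : nat -> R) :
  (forall n, 0 <= eta n) ->
  (forall n x, (0 < n <= k)%N -> `|G n x| <= A) ->
  (forall n x, (k < n)%N ->
    `|G n x - \sum_(b <- bl) q b * G (n - b.1)%N (x - xi b)| <= eta n) ->
  forall n x, (0 < n)%N -> `|G n x| <= A + \sum_(j < n.+1) eta j.
Proof.
move=> eta0 G0 Gstep; elim/ltn_ind => n IH x n0.
have s0 m : 0 <= \sum_(j < m) eta j by rewrite sumr_ge0.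
have [nk|kn] := leqP n k.
  by rewrite (le_trans (G0 _ _ _)) ?n0// lerDl.
rewrite -[G n x](subrK (\sum_(b <- bl) q b * G (n - b.1)%N (x - xi b))).
rewrite (le_trans (ler_normD _ _))// big_ord_recr/= addrA addrC lerD ?Gstep//.
apply: norm_sum_q => b bbl.
have nb : ((n - b.1).+1 <= n)%N.
  by have /andP[b0 _] := bl_len bbl; rewrite ltn_subrL b0.
rewrite (le_trans (IH _ nb _ (bl_gt kn bbl)))// lerD2l.
have mono p m : \sum_(j < p) eta j <= \sum_(j < p + m) eta j.
  by rewrite big_split_ord/= lerDl sumr_ge0.
by have := mono (n - b.1).+1 (n - (n - b.1).+1)%N; rewrite subnKC.
Qed.

(** Up to the factor [mass n], the distribution function of the centred digit sum plus independent
    N(0, s0) noise. *)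
Definition smooth (s0 : R) n x :=
  tilt n (fun w => heat s0 (x - (w%:R - mu * n%:R))).

Lemma smooth_rec s0 n x : (k < n)%N ->
  smooth s0 n x = \sum_(b <- bl) q b * smooth s0 (n - b.1)%N (x - xi b).
Proof.
move=> kn; rewrite /smooth tilt_rec// big_seq [RHS]big_seq.
apply: eq_bigr => b bbl; congr (_ * _); apply: eq_tilt => w.
by rewrite shiftE ?(bl_le kn bbl)//; congr heat; ring.
Qed.

Definition smooth_err s0 n x := smooth s0 n x - mass n * heat (s0 + sigma2 * n%:R) x.

(** Both terms of [smooth_err] follow the renewal equation up to the average of mass(n - b.1) times
    [D b]. Splitting the mass as kap plus a decaying rest, the Taylor terms are inserted for free in
    the kap part because their averages vanish. *)
Lemma smooth_err_step s0 n x kap :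
  (k < n)%N ->
  let s := s0 + sigma2 * n%:R in
  let D b := heat (s - sigma2 * b.1%:R) (x - xi b) - heat s x in
  smooth_err s0 n x
    - \sum_(b <- bl) q b * smooth_err s0 (n - b.1)%N (x - xi b)
  = \sum_(b <- bl) q b * (kap * (D b
       - (- xi b) * (phi (x / Num.sqrt s) / Num.sqrt s)
       + ((- xi b) ^+ 2 - sigma2 * b.1%:R)
         * (x / Num.sqrt s * phi (x / Num.sqrt s) / (2 * s)))
    + (mass (n - b.1)%N - kap) * D b).
Proof.
move=> kn s D; set P := _ / Num.sqrt s; set Q := _ / (2 * s).
transitivity (\sum_(b <- bl) q b * (mass (n - b.1)%N * D b)).
  rewrite /smooth_err smooth_rec// mass_rec// mulr_suml -!sumrB.
  rewrite big_seq [RHS]big_seq; apply: eq_bigr => b bbl.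
  have bn := bl_le kn bbl.
  have -> : s0 + sigma2 * (n - b.1)%:R = s - sigma2 * b.1%:R.
    by rewrite natrB// /s; ring.
  by rewrite /D -/s; ring.
apply/eqP; rewrite -subr_eq0 -sumrB; apply/eqP.
transitivity (\sum_(b <- bl) (q b * xi b * (- (kap * P))
   + q b * (xi b ^+ 2 - sigma2 * b.1%:R) * (- (kap * Q)))).
  by apply: eq_bigr => b _; rewrite sqrrN; ring.
by rewrite big_split/= -!mulr_suml sum_q_xi sum_q_xi2 !mul0r addr0.
Qed.

Lemma initial_bound : exists2 M : R, xi_bound <= M &
  forall n w, (0 < n <= k)%N -> w \in L n -> `|w%:R - mu * n%:R| <= M /\ mass n <= M.
Proof.
pose S := \sum_(n < k.+1) (\sum_(w <- L n) `|w%:R - mu * n%:R| + mass n).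
have m0 n : 0 <= mass n by rewrite massE mulr_ge0// exprn_ge0// ltW.
have S0 n : 0 <= \sum_(w <- L n) `|w%:R - mu * n%:R| by rewrite sumr_ge0.
have X0 := xi_bound_ge1.
exists (xi_bound + S) => [|n w /andP[n0 nk] wL].
  by rewrite lerDl sumr_ge0// => i _; rewrite addr_ge0.
have le_S : \sum_(w <- L n) `|w%:R - mu * n%:R| + mass n <= S.
  rewrite /S (bigD1 (inord n))//= inordK// lerDl sumr_ge0// => i _.
  by rewrite addr_ge0.
have wS : `|w%:R - mu * n%:R| <= \sum_(w <- L n) `|w%:R - mu * n%:R|.
  by rewrite [leRHS](big_rem w)//= lerDl sumr_ge0.
by have := m0 n; have := S0 n; split; lra.
Qed.

Lemma tilt_cst n c : tilt n (fun=> c) = mass n * c.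
Proof. by rewrite mulrC /mass -tiltZ mulr1. Qed.

Lemma tilt_subr n F c : tilt n (fun w => F w - c) = tilt n F - mass n * c.
Proof. by rewrite (tiltD n F (fun=> - c)) tilt_cst mulrN. Qed.

(** All steps are bounded by [M] and all times are at least rs^2, so the relative step M / rs serves
    as the [e] of [heat_step] throughout. *)
Lemma heat_step_unif (s h x u rs M : R) : 1 <= M -> 2 * M <= rs ->
  rs ^+ 2 <= s -> `|u| <= M -> 0 <= h <= M ->
  `|heat (s - h) (x + u) - heat s x| <= 7 * Cphi R * (M / rs) /\
  `|heat (s - h) (x + u) - heat s x
    - u * (phi (x / Num.sqrt s) / Num.sqrt s)
    + (u ^+ 2 - h) * (x / Num.sqrt s * phi (x / Num.sqrt s) / (2 * s))|
  <= 5 * Cphi R * (M / rs) ^+ 3.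
Proof.
move=> M1 Mrs rss uM /andP[h0 hM].
have rs0 : 0 < rs by lra.
have s0 : 0 < s by rewrite (lt_le_trans _ rss)// exprn_gt0.
have e0 : 0 <= M / rs by rewrite divr_ge0//; lra.
have e1 : 0 <= M / rs <= 2^-1 by rewrite e0/= ler_pdivrMr//; lra.
have rsE : rs <= Num.sqrt s.
  by rewrite -[rs]ger0_norm ?(ltW rs0)// -sqrtr_sqr ler_wsqrtr.
have u1 : `|u| <= M / rs * Num.sqrt s.
  rewrite (le_trans uM)// mulrAC -mulrA ler_peMr//; first by lra.
  by rewrite ler_pdivlMr// mul1r.
have h1 : 0 <= h <= (M / rs) ^+ 2 * s.
  rewrite h0/= (le_trans hM)// (@le_trans _ _ (M ^+ 2))//; first by nra.
  rewrite expr_div_n mulrAC -mulrA ler_peMr ?sqr_ge0//.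
  by rewrite ler_pdivlMr ?exprn_gt0// mul1r.
split; first exact: heat_step0.
exact: heat_step.
Qed.

(** The initial error and the part carried by the decaying mass - kap are O(1/rs) in total, the
    latter by a geometric sum; the Taylor remainders cost O(rs^-3) at each of the n steps. *)
Lemma lindeberg : exists B rs0 : R, [/\ 0 <= B, 0 < rs0 &
  forall rs n x, rs0 <= rs -> (0 < n)%N ->
    `|smooth_err (rs ^+ 2) n x| <= B * (rs^-1 + n%:R / rs ^+ 3)].
Proof.
have [th [kap [C [th01 C0 massC _ _]]]] := moment_bounds.
have /andP[th0 th1] := th01.
have [M XM Minit] := initial_bound.
have M1 : 1 <= M by rewrite (le_trans xi_bound_ge1).
have K0 := Cphi_ge0 R.
have sM j : (j <= k)%N -> 0 <= sigma2 * j%:R <= M.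
  have s0 := ltW sigma2_gt0.
  move=> jk; rewrite mulr_ge0//= (le_trans _ XM)// /xi_bound.
  have h1 : sigma2 * j%:R <= sigma2 * k%:R by rewrite ler_wpM2l// ler_nat.
  have h2 : 0 <= \sum_(b <- bl) (`|xi b| + `|xi b| ^+ 2).
    by rewrite sumr_ge0// => b _; rewrite addr_ge0// exprn_ge0.
  by lra.
pose B1 := 7 * Cphi R * M ^+ 2.
pose B2 := `|kap| * (5 * Cphi R) * M ^+ 3.
pose B3 := C / th ^+ k * (7 * Cphi R * M).
have t10 : 0 < 1 - th by rewrite subr_gt0.
have M0 : 0 <= M by lra.
have B10 : 0 <= B1 by rewrite /B1; nneg.
have B20 : 0 <= B2 by rewrite /B2; nneg.
have B30 : 0 <= B3 by rewrite /B3; nneg.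
exists (B1 + 2 * B2 + B3 / (1 - th)), (2 * M); split.
- by nneg.
- by lra.
move=> rs n x rsM n0; have rs0 : 0 < rs by lra.
pose e := M / rs.
pose eta j := `|kap| * (5 * Cphi R * e ^+ 3) + C / th ^+ k * (7 * Cphi R * e) * th ^+ j.
have e0 : 0 <= e by rewrite divr_ge0//; lra.
have K7e : 0 <= 7 * Cphi R * e by nneg.
have eta0 j : 0 <= eta j.
  by rewrite /eta; nneg.
have ss m : rs ^+ 2 <= rs ^+ 2 + sigma2 * m%:R.
  by rewrite lerDl mulr_ge0// ltW// sigma2_gt0.
have step0 m z : (0 < m <= k)%N -> `|smooth_err (rs ^+ 2) m z| <= M * (7 * Cphi R * e).
  move=> m0k; rewrite /smooth_err /smooth -tilt_subr.
  rewrite /tilt normrM ger0_norm ?exprn_ge0 ?(ltW y0)//.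
  have /andP[m0 mk] := m0k; have mL := L_neq0 m0.
  have [|_ mM] := Minit m (head 0%N (L m)) m0k.
    by case: (L m) mL => //= a l _; rewrite mem_head.
  rewrite mulrC [leRHS]mulrC -/e.
  apply: (@le_trans _ _ (7 * Cphi R * e * mass m)); last first.
    by rewrite ler_wpM2l.
  rewrite massE [_ * (size _)%:R]mulrC mulrA ler_wpM2r ?exprn_ge0 ?(ltW y0)//.
  rewrite (le_trans (ler_norm_sum _ _ _))//.
  have -> : 7 * Cphi R * e * (size (L m))%:R = \sum_(w <- L m) (7 * Cphi R * e).
    by rewrite big_const_seq count_predT iter_addr_0 mulr_natr.
  rewrite big_seq [leRHS]big_seq; apply: ler_sum => w wL.
  have [wM _] := Minit m w m0k wL.
  have wM' : `|- (w%:R - mu * m%:R)| <= M by rewrite normrN.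
  have [+ _] := heat_step_unif z M1 rsM (ss m) wM' (sM m mk).
  by rewrite addrK.
have stepn m z : (k < m)%N -> `|smooth_err (rs ^+ 2) m z
    - \sum_(b <- bl) q b * smooth_err (rs ^+ 2) (m - b.1)%N (z - xi b)| <= eta m.
  move=> km; rewrite (smooth_err_step _ _ kap km); apply: norm_sum_q => b bbl.
  have /andP[b0 bk] := bl_len bbl.
  have [xb _] := xi_le_bound bbl.
  have xM : `|- xi b| <= M by rewrite normrN (le_trans xb).
  have [h1 h2] := heat_step_unif z M1 rsM (ss m) xM (sM _ bk).
  rewrite (le_trans (ler_normD _ _))// /eta lerD//.
    by rewrite normrM ler_wpM2l.
  rewrite normrM [leRHS]mulrAC ler_pM//.
  rewrite (le_trans (massC _ (bl_gt km bbl)))//.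
  rewrite -mulrA ler_wpM2l// mulrC ler_pdivlMr ?exprn_gt0//.
  rewrite -exprD ler_wiXn2l ?(ltW th0) ?(ltW th1)//.
  by move: (b.1) bk km; clear; move=> *; lia.
rewrite (le_trans (maximum_principle eta0 step0 stepn x n0))//.
have e1 : M * (7 * Cphi R * e) = B1 * rs^-1 by rewrite /B1 /e; ring.
have e2 : `|kap| * (5 * Cphi R * e ^+ 3) = B2 / rs ^+ 3.
  by rewrite /B2 /e expr_div_n; ring.
have e3 : C / th ^+ k * (7 * Cphi R * e) = B3 * rs^-1 by rewrite /B3 /e; ring.
rewrite /eta big_split/= sumr_const card_ord -mulr_sumr e1 e2 e3 -[_ *+ n.+1]mulr_natr.
have S := @sum_geometric th n.+1 th01.
have a0 : 0 <= rs^-1 by rewrite invr_ge0 ltW.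
have b0 : 0 <= (rs ^+ 3)^-1 by rewrite invr_ge0 exprn_ge0// ltW.
have N1 : 1 <= n%:R :> R by rewrite ler1n.
rewrite -natr1.
move: a0 b0 N1 S B10 B20 B30 t10; clear.
move: (rs^-1) ((rs ^+ 3)^-1) (n%:R) B1 B2 B3 (\sum_(i < n.+1) _).
move=> a b N B1 B2 B3 S a0 b0 N1 S1 B10 B20 B30 t10.
have t1 : 0 <= (1 - th)^-1 by rewrite invr_ge0 ltW.
have h1 := ler_wpM2l (mulr_ge0 B30 a0) S1.
have h2 : 0 <= B1 * (N * b) by nneg.
have h3 : 0 <= B2 * a by nneg.
have h4 : 0 <= B3 / (1 - th) * (N * b) by nneg.
have h5 : B2 * b <= B2 * b * N by rewrite ler_peMr// mulr_ge0.
move: (1 - th)^-1 h1 h4 => T h1 h4.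
lra.
Qed.

(** * Removing the smoothing *)

Definition cdfL n x : R :=
  (count (fun w => w%:R - mu * n%:R <= x) (L n))%:R / (size (L n))%:R.

Lemma cdfLE n x : cdfL n x =
  tilt n (fun w => (w%:R - mu * n%:R <= x :> R)%R%:R) / mass n.
Proof.
rewrite /cdfL massE /tilt -sum1_count natr_sum big_mkcond/=.
rewrite invfM mulrACA divff ?mul1r ?gt_eqF ?exprn_gt0//.
by congr (_ / _); apply: eq_bigr => w _; case: ifP.
Qed.

(** Shifting by A rs puts every word counted by the indicator at a point where [Phi] is at least 1 -
    e, so the shifted smooth function plus e dominates the indicator. *)
Lemma cdfL_upper rs n x A e : 0 < rs -> (0 < n)%N -> 0 <= e ->
  (forall u, A <= u -> 1 - e <= Phi u) ->
  cdfL n x <= smooth (rs ^+ 2) n (x + A * rs) / mass n + e.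
Proof.
move=> rs0 n0 e0 PhiA; have m0 := mass_gt0 n0.
have -> : e = tilt n (fun=> e) / mass n by rewrite tilt_cst mulrC mulKf// gt_eqF.
rewrite cdfLE -mulrDl ler_pM2r ?invr_gt0// -tiltD; apply: le_tilt => w.
have [wx|_] := leP (w%:R - mu * n%:R) x; last by rewrite addr_ge0// heat_ge0.
rewrite -lerBlDr; apply: PhiA.
by rewrite sqrtr_sqr gtr0_norm// ler_pdivlMr//; lra.
Qed.

Lemma cdfL_lower rs n x A e : 0 < rs -> (0 < n)%N -> 0 <= e ->
  (forall u, u <= - A -> Phi u <= e) ->
  smooth (rs ^+ 2) n (x - A * rs) / mass n - e <= cdfL n x.
Proof.
move=> rs0 n0 e0 PhiA; have m0 := mass_gt0 n0.
rewrite lerBlDr.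
have -> : e = tilt n (fun=> e) / mass n by rewrite tilt_cst mulrC mulKf// gt_eqF.
rewrite cdfLE -mulrDl ler_pM2r ?invr_gt0// -tiltD; apply: le_tilt => w.
have [wx|wx] := leP (w%:R - mu * n%:R) x; first by rewrite ler_wpDr// heat_le1.
rewrite add0r; apply: PhiA.
by rewrite sqrtr_sqr gtr0_norm// ler_pdivrMr//; lra.
Qed.

(** A single heat step with h = d^2 and xi = A d up to sign; d (A + 1) dominates both d and A d,
    which explains the relative step size. *)
Lemma heat_smoothing d A x : 0 < d -> 0 < A ->
  d * (A + 1) <= Num.sqrt sigma2 / 2 ->
  `|heat (sigma2 + d ^+ 2) (x + A * d) - heat sigma2 x|
    <= 7 * Cphi R * (d * (A + 1) / Num.sqrt sigma2) /\
  `|heat (sigma2 + d ^+ 2) (x - A * d) - heat sigma2 x|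
    <= 7 * Cphi R * (d * (A + 1) / Num.sqrt sigma2).
Proof.
move=> d0 A0 dA; set sg := Num.sqrt sigma2 in dA *.
have sg0 : 0 < sg by rewrite sqrtr_gt0 sigma2_gt0.
have sg2 : sg ^+ 2 = sigma2 by rewrite sqr_sqrtr// ltW// sigma2_gt0.
set e := d * (A + 1) / sg.
have dA0 : 0 <= d * (A + 1) by rewrite mulr_ge0//; lra.
have e0 : 0 <= e by rewrite divr_ge0// ltW.
have e1 : 0 <= e <= 2^-1.
  by rewrite e0/= ler_pdivrMr// [leRHS]mulrC.
pose s := sigma2 + d ^+ 2.
have sE : s - d ^+ 2 = sigma2 by rewrite /s addrK.
have s0 : 0 < s by rewrite addr_gt0 ?sigma2_gt0// exprn_gt0.
have sgs : sg <= Num.sqrt s by rewrite ler_wsqrtr// lerDl sqr_ge0.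
have es : d * (A + 1) <= e * Num.sqrt s.
  rewrite (@le_trans _ _ (e * sg))//; first by rewrite /e divfK// gt_eqF.
  by rewrite ler_wpM2l.
have h : 0 <= d ^+ 2 <= e ^+ 2 * s.
  rewrite sqr_ge0/= -[s in leRHS]sqr_sqrtr ?(ltW s0)// -exprMn.
  rewrite lerXn2r ?nnegrE ?(ltW d0)// ?(le_trans _ es)//.
  by rewrite ler_peMr ?(ltW d0)//; lra.
have Ad : `|A * d| <= e * Num.sqrt s.
  rewrite gtr0_norm ?mulr_gt0// (le_trans _ es)//.
  by rewrite mulrC ler_wpM2l ?(ltW d0)//; lra.
have Ad' : `|- (A * d)| <= e * Num.sqrt s by rewrite normrN.
split; rewrite distrC.
  by have := heat_step0 (x + A * d) s0 e1 Ad' h; rewrite sE addrK.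
by have := heat_step0 (x - A * d) s0 e1 Ad h; rewrite sE subrK.
Qed.

Lemma cdfL_cvg (eps : R) : 0 < eps -> exists N, forall n x, (N <= n)%N ->
  `|cdfL n (x * Num.sqrt n%:R) - heat sigma2 x| <= eps.
Proof.
move=> eps0; have [B [rs0 [B0 rs00 lind]]] := lindeberg.
have e40 : 0 < eps / 4 by lra.
have [A A0 [Aup Alow]] := Phi_tails e40.
set sg := Num.sqrt sigma2.
have sg0 : 0 < sg by rewrite sqrtr_gt0 sigma2_gt0.
have K0 := Cphi_ge0 R.
(* The first entry of the minimum meets the condition of [heat_smoothing]; the second brings its
   error down to eps/4. *)
pose d := Num.min (sg / 2) (eps * sg / (4 * (7 * Cphi R + 1))) / (A + 1).
have A10 : 0 < A + 1 by lra.
have K1 : 0 < 4 * (7 * Cphi R + 1) by lra.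
have d0 : 0 < d.
  by rewrite divr_gt0// lt_min !divr_gt0// mulr_gt0.
have dA1 : d * (A + 1) <= sg / 2 by rewrite divfK ?gt_eqF// ge_min lexx.
have dA2 : 7 * Cphi R * (d * (A + 1) / sg) <= eps / 4.
  have : d * (A + 1) <= eps * sg / (4 * (7 * Cphi R + 1)).
    by rewrite divfK ?gt_eqF// ge_min lexx orbT.
  rewrite ler_pdivlMr// => h.
  rewrite (_ : _ * (_ / sg) = 7 * Cphi R * (d * (A + 1)) / sg); last by ring.
  rewrite ler_pdivrMr//.
  have : 0 <= d * (A + 1) by rewrite mulr_ge0 ?(ltW d0) ?(ltW A10).
  by move: h; set t := d * (A + 1); lra.
pose D := B / y ^+ k * (d^-1 + (d ^+ 3)^-1).
have yk0 : 0 < y ^+ k by rewrite exprn_gt0.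
have D0 : 0 <= D by rewrite /D; nneg.
(* Once sqrt(n) exceeds [bnd], the scale d sqrt(n) is admissible for [lindeberg] and its error D /
   sqrt(n) is at most eps/4. *)
pose bnd := Num.max (rs0 / d) (D / (eps / 4)).
exists (Num.trunc (bnd ^+ 2)).+1 => n x nN.
have n0 : (0 < n)%N by rewrite (leq_trans _ nN).
have nR : 0 < n%:R :> R by rewrite ltr0n.
set r := Num.sqrt n%:R; have r0 : 0 < r by rewrite sqrtr_gt0.
have r2 : r ^+ 2 = n%:R by rewrite sqr_sqrtr// ltW.
have bnd0 : 0 <= bnd by rewrite le_max divr_ge0// ltW.
have rb : bnd <= r.
  rewrite -ler_sqr ?nnegrE ?(ltW r0)// r2.
  rewrite (le_trans (ltW (truncnS_gt _)))//  ler_nat.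
  exact: nN.
have rs0d : rs0 <= d * r.
  by rewrite mulrC -ler_pdivrMr// (le_trans _ rb)// le_max lexx.
have Dr : D / r <= eps / 4.
  rewrite ler_pdivrMr// mulrC -ler_pdivrMr// (le_trans _ rb)//.
  by rewrite le_max lexx orbT.
have dr0 : 0 < d * r by rewrite mulr_gt0.
have m0 := mass_gt0 n0.
have main z : `|smooth ((d * r) ^+ 2) n (z * r) / mass n
                - heat (sigma2 + d ^+ 2) z| <= eps / 4.
  rewrite (le_trans _ Dr)//.
  (* Homogeneity: V(r^2 s, r x) = V(s, x), here with r^2 = n. *)
  have -> : heat (sigma2 + d ^+ 2) z = heat ((d * r) ^+ 2 + sigma2 * n%:R) (z * r).
    have -> : (d * r) ^+ 2 + sigma2 * n%:R = (sigma2 + d ^+ 2) * n%:R.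
      by rewrite -r2; ring.
    rewrite /heat; congr Phi.
    rewrite sqrtrM ?addr_ge0 ?sqr_ge0 ?(ltW sigma2_gt0)// -/r.
    by rewrite -mulf_div divff ?mulr1// gt_eqF.
  have := lind (d * r) n (z * r) rs0d n0; rewrite /smooth_err => h.
  rewrite -[heat _ _](mulKf (x := mass n)) ?gt_eqF// [X in _ - X]mulrC -mulrBl.
  rewrite normrM normfV [`|mass n|]gtr0_norm// ler_pdivrMr//.
  apply: (le_trans h).
  have -> : (d * r)^-1 + n%:R / (d * r) ^+ 3 = (d^-1 + (d ^+ 3)^-1) / r.
    by rewrite -r2; field; rewrite !gt_eqF.
  set t := d^-1 + _; have t0 : 0 <= t / r by rewrite /t; nneg.
  rewrite (_ : D / r * mass n = B * (t / r) * (mass n / y ^+ k)); last first.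
    by rewrite /D -/t; ring.
  rewrite ler_peMr ?(mulr_ge0 B0 t0)//.
  by rewrite ler_pdivlMr// mul1r mass_ge.
have [h1 h2] := heat_smoothing x d0 A0 dA1.
have up := cdfL_upper (x * r) dr0 n0 (ltW e40) Aup.
have lo := cdfL_lower (x * r) dr0 n0 (ltW e40) Alow.
have mu1 := main (x + A * d); have ml1 := main (x - A * d).
rewrite (_ : (x + A * d) * r = x * r + A * (d * r)) in mu1; last by ring.
rewrite (_ : (x - A * d) * r = x * r - A * (d * r)) in ml1; last by ring.
have {}h1 := le_trans h1 dA2; have {}h2 := le_trans h2 dA2.
move: up lo mu1 ml1 h1 h2; clear.
set a := cdfL _ _; set b := heat sigma2 x; set c := heat _ _; set c' := heat _ _.
set f := smooth _ _ _ / _; set f' := smooth _ _ _ / _.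
rewrite !ler_norml => up lo /andP[? ?] /andP[? ?] /andP[? ?] /andP[? ?].
by apply/andP; split; lra.
Qed.

(** * Mean, variance and central limit theorem for the lists *)

Definition meanL n : R := (\sum_(w <- L n) w%:R) / (size (L n))%:R.
Definition varL n : R :=
  (\sum_(w <- L n) (w%:R - meanL n) ^+ 2) / (size (L n))%:R.

Lemma tilt_avg n F : tilt n F / mass n = (\sum_(w <- L n) F w) / (size (L n))%:R.
Proof.
by rewrite massE /tilt invfM mulrACA divff ?mul1r ?gt_eqF ?exprn_gt0.
Qed.

Lemma meanLE n : (0 < n)%N -> meanL n - mu * n%:R = dev1 n / mass n.
Proof.
move=> n0; rewrite /dev1 tilt_subr mulrBl tilt_avg [mass n * _]mulrC mulfK//.
by rewrite gt_eqF// mass_gt0.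
Qed.

(** The variance is the second moment about [mu * n] minus the square of the bias of that centre. *)
Lemma varLE n : (0 < n)%N ->
  varL n - sigma2 * n%:R = dev2 n / mass n - (meanL n - mu * n%:R) ^+ 2.
Proof.
move=> n0; have m0 := mass_gt0 n0; have mu0 : mass n != 0 by rewrite gt_eqF.
pose a := meanL n - mu * n%:R.
have aE : dev1 n = mass n * a by rewrite /a meanLE// mulrC divfK.
rewrite /varL -tilt_avg -/a; apply: (mulIf mu0); rewrite !mulrBl !divfK//.
have -> : tilt n (fun w => (w%:R - meanL n) ^+ 2) =
    tilt n (fun w => ((w%:R - mu * n%:R) ^+ 2 - sigma2 * n%:R)
                     + (- 2 * a) * (w%:R - mu * n%:R))
    - mass n * (- (sigma2 * n%:R + a ^+ 2)).
  by rewrite -tilt_subr; apply: eq_tilt => w; rewrite /a; ring.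
by rewrite tiltD tiltZ -/(dev1 n) -/(dev2 n) aE; ring.
Qed.

Lemma moments_linear : exists2 C : R, 0 <= C & forall n, (0 < n)%N ->
  `|meanL n - mu * n%:R| <= C /\ `|varL n - sigma2 * n%:R| <= C.
Proof.
have [th [kap [C [_ C0 _ C1 C2]]]] := moment_bounds.
have yk0 : 0 < y ^+ k by rewrite exprn_gt0.
pose C' := C / y ^+ k; have C'0 : 0 <= C' by rewrite divr_ge0// ltW.
have dm x n : (0 < n)%N -> `|x| <= C -> `|x / mass n| <= C'.
  move=> n0 xC; have m0 := mass_gt0 n0.
  rewrite normrM normfV (gtr0_norm m0) ler_pM ?invr_ge0 ?(ltW m0)//.
  by rewrite lef_pV2 ?posrE// mass_ge.
exists (C' + C' ^+ 2); first by rewrite addr_ge0// sqr_ge0.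
move=> n n0; have h1 := dm _ _ n0 (C1 n n0); have h2 := dm _ _ n0 (C2 n n0).
rewrite varLE// meanLE//; split; first by rewrite (le_trans h1)// lerDl sqr_ge0.
rewrite (le_trans (ler_normB _ _))// lerD//.
by rewrite normrX lerXn2r ?nnegrE.
Qed.

Lemma sqrt_dist1 (t : R) : 0 <= t -> `|Num.sqrt t - 1| <= `|t - 1|.
Proof.
move=> t0; have s0 := sqrtr_ge0 t.
have -> : t - 1 = (Num.sqrt t - 1) * (Num.sqrt t + 1).
  by rewrite -[t in LHS](sqr_sqrtr t0); ring.
by rewrite normrM ler_peMr// ger0_norm; lra.
Qed.

(** Exact standardisation replaces [x] by a point [z] that moves with n. The uniformity of
    [cdfL_cvg] in its argument allows evaluation there, and [Phi] is Lipschitz. *)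
Lemma cltL (x : R) :
  (count (fun w => (w%:R - meanL n) / Num.sqrt (varL n) <= x) (L n))%:R
    / (size (L n))%:R @[n --> \oo] --> Phi x.
Proof.
apply/cvgrPdist_le => eps eps0.
have [C C0 moms] := moments_linear.
have e20 : 0 < eps / 2 by lra.
have [N Ncvg] := cdfL_cvg e20.
have s20 := sigma2_gt0; set sg := Num.sqrt sigma2.
have sg0 : 0 < sg by rewrite sqrtr_gt0.
have sg2 : sg ^+ 2 = sigma2 by rewrite sqr_sqrtr// ltW.
have K0 := Cphi_ge0 R.
pose D := C / sg + `|x| * (C / sigma2).
have D0 : 0 <= D by rewrite /D; nneg.
(* The first entry makes [varL n] positive; the second makes Cphi D / sqrt(n) at most eps/2. *)
pose bnd := Num.max (C / sigma2) ((Cphi R * D / (eps / 2)) ^+ 2).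
near=> n.
have nN : (N <= n)%N by near: n; exact: nbhs_infty_ge.
have n0 : (0 < n)%N by near: n; exact: nbhs_infty_gt.
have nb : bnd < n%:R by near: n; exact: nbhs_infty_gtr.
have nR : 1 <= n%:R :> R by rewrite ler1n.
pose r : R := Num.sqrt n%:R.
have r1 : 1 <= r by rewrite -[leLHS]sqrtr1 ler_wsqrtr.
have r2 : r ^+ 2 = n%:R by rewrite sqr_sqrtr.
have r0 : 0 < r by lra.
have [mE vE] := moms n n0.
have Cn : C < sigma2 * n%:R.
  rewrite mulrC -ltr_pdivrMr//; apply: le_lt_trans nb.
  by rewrite le_max lexx.
have v0 : 0 < varL n by move: vE; rewrite ler_norml => /andP[? _]; lra.
set sv := Num.sqrt (varL n); have sv0 : 0 < sv by rewrite sqrtr_gt0.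
pose z := (meanL n - mu * n%:R + x * sv) / r.
have -> : (count (fun w => (w%:R - meanL n) / sv <= x) (L n))%:R
    / (size (L n))%:R = cdfL n (z * r).
  rewrite /cdfL; congr (_%:R / _); apply: eq_count => w /=.
  rewrite /z divfK ?gt_eqF// ler_pdivrMr//.
  by apply/idP/idP => ?; lra.
have h1 := Ncvg n z nN.
have h2 : `|Phi x - heat sigma2 z| <= eps / 2.
  rewrite /heat (le_trans (Phi_lipschitz _ _))// -/sg.
  have zx : `|x - z / sg| <= D / r.
    pose t := varL n / (sigma2 * n%:R).
    have t0 : 0 <= t by rewrite /t; nneg.
    have svE : sv = Num.sqrt t * (sg * r).
      rewrite /sg /r -sqrtrM ?(ltW s20)// -sqrtrM// /t divfK//.
      by rewrite gt_eqF// mulr_gt0//; lra.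
    have -> : x - z / sg = - ((meanL n - mu * n%:R) / (sg * r)) - x * (Num.sqrt t - 1).
      by rewrite /z svE; field; rewrite !gt_eqF.
    rewrite (le_trans (ler_normB _ _))// normrN /D [leRHS]mulrDl lerD//.
      rewrite normrM normfV (gtr0_norm (mulr_gt0 sg0 r0)) invfM mulrA.
      by rewrite !ler_wpM2r// invr_ge0 ltW.
    rewrite normrM -mulrA ler_wpM2l// (le_trans (sqrt_dist1 t0))//.
    have -> : t - 1 = (varL n - sigma2 * n%:R) / (sigma2 * n%:R).
      by rewrite /t; field; rewrite !gt_eqF//; lra.
    rewrite normrM normfV [`|sigma2 * _|]gtr0_norm; last first.
      by rewrite mulr_gt0//; lra.
    rewrite invfM mulrA ler_pM ?mulr_ge0 ?invr_ge0 ?(ltW s20)//.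
      by rewrite ler_wpM2r// invr_ge0 ltW.
    by rewrite lef_pV2 ?posrE// -?r2; [nra|lra].
  apply: (le_trans (ler_wpM2l K0 zx)); rewrite mulrA.
  rewrite ler_pdivrMr// [leRHS]mulrC -ler_pdivrMr//.
  rewrite -ler_sqr ?nnegrE ?(ltW r0)//; last by nneg.
  by rewrite r2 ltW//; apply: le_lt_trans nb; rewrite le_max lexx orbT.
have -> : Phi x - cdfL n (z * r) =
  (Phi x - heat sigma2 z) - (cdfL n (z * r) - heat sigma2 z) by ring.
by rewrite (le_trans (ler_normB _ _))//; lra.
Unshelve. all: by end_near.
Qed.
End renewal.

(** * Admissible words *)

Section words.
Variable cs : seq nat.

(* [acc r a]: reading the digits [a] from the state in which [r] is the part of
   [c_1, ..., c_k] still to be matched never gets stuck. *)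
Fixpoint acc (r a : seq nat) {struct a} : bool :=
  match r, a with
  | [::], _ => false
  | _ :: _, [::] => true
  | c :: r', d :: a' => if (d < c)%N then acc cs a' else (d == c) && acc r' a'
  end.

Fixpoint words (n : nat) (r : seq nat) : seq (seq nat) :=
  match r, n with
  | [::], _ => [::]
  | _ :: _, 0%N => [:: [::]]
  | c :: r', m.+1 => [seq d :: a | d <- iota 0 c, a <- words m cs]
                       ++ [seq c :: a | a <- words m r']
  end.

Lemma mem_words n r a : (a \in words n r) = (size a == n) && acc r a.
Proof.
elim: n r a => [|n IH] [|c r] [|d a]; rewrite ?in_nil ?andbF//=.
  rewrite mem_cat; apply/negbTE; rewrite negb_or.
  by apply/andP; split; apply/negP; [case/allpairsPdep => ? [? []]|case/mapP].
rewrite mem_cat eqSS; apply/orP/idP.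
  case=> [/allpairsPdep[e [b [+ + [-> ->]]]]|/mapP[b + [-> ->]]].
    by rewrite mem_iota add0n IH => /andP[_ ->].
  by rewrite IH ltnn eqxx.
case/andP=> sa; case: ifP => [dc aa|_ /andP[/eqP -> aa]].
  left; apply/allpairsPdep; exists d, a; split => //.
    by rewrite mem_iota add0n dc.
  by rewrite IH sa.
by right; apply/mapP; exists a; rewrite // IH sa.
Qed.

Lemma uniq_words n r : uniq (words n r).
Proof.
elim: n r => [|n IH] [|c r]//=.
rewrite cat_uniq; apply/and3P; split.
- apply: allpairs_uniq_dep => //; first exact: iota_uniq.
  by move=> [? ?] [? ?] _ _ /= [-> ->].
- apply/hasPn => _ /mapP[b _ ->]; apply/negP => /allpairsPdep[d [b' [+ _ [dc _]]]].
  by rewrite mem_iota -dc add0n ltnn andbF.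
- by rewrite map_inj_uniq// => ? ? [].
Qed.

(** The automaton gets stuck if it matches all of [r], so an accepted word at least as long as [r]
    has a first position [i] with a digit [d] below that of [r]; the automaton restarts after it. *)
Lemma sum_words_block (V : nmodType) n r (F : seq nat -> V) :
  (size r <= n)%N ->
  \sum_(a <- words n r) F a = \sum_(0 <= i < size r) \sum_(0 <= d < nth 0%N r i)
    \sum_(a <- words (n - i.+1) cs) F (take i r ++ d :: a).
Proof.
elim: r n F => [|c r IH] n F /=; first by case: n => [|n] _; rewrite big_nil big_nil.
case: n => // n; rewrite ltnS => rn /=.
rewrite big_cat big_nat_recl//= subSS subn0; congr (_ + _).
  by rewrite big_allpairs_dep/= /index_iota subn0.
by rewrite big_map IH.
Qed.

Definition blocks : seq (nat * nat) :=
  [seq (i.+1, (sumn (take i cs) + d)%N) | i <- iota 0 (size cs), d <- iota 0 (nth 0%N cs i)].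

Definition weights n : seq nat :=
  [seq sumn a | a <- words n cs & (0 < last 0 a)%N].

Lemma weights_rec (V : nmodType) n (F : nat -> V) : (size cs < n)%N ->
  \sum_(w <- weights n) F w =
  \sum_(b <- blocks) \sum_(w <- weights (n - b.1)%N) F (b.2 + w)%N.
Proof.
move=> kn; rewrite big_allpairs_dep/= /weights big_map big_filter.
rewrite big_mkcond sum_words_block 1?ltnW//= /index_iota subn0 big_seq [RHS]big_seq.
apply: eq_bigr => i; rewrite mem_iota/= add0n => ik.
rewrite subn0; apply: eq_bigr => d _.
rewrite big_map big_filter [RHS]big_mkcond/= big_seq [RHS]big_seq.
apply: eq_bigr => a; rewrite mem_words => /andP[/eqP sa _].
(* The rest after the first block is nonempty, so the condition on the last digit concerns the rest
   alone. *)
have a0 : (0 < size a)%N by rewrite sa subn_gt0 (leq_ltn_trans ik).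
rewrite last_cat/= sumn_cat/= addnA.
by case: a a0 {sa}.
Qed.

Hypothesis cs_pos : all (leq 1) cs.
Hypothesis cs_size : (1 < size cs)%N.

Lemma nth_cs_gt0 i : (i < size cs)%N -> (0 < nth 0 cs i)%N.
Proof. by move=> ik; apply: (allP cs_pos); rewrite mem_nth. Qed.

Let cs_cons : exists c r, cs = [:: c & r] /\ (0 < c)%N.
Proof.
by case: cs cs_pos cs_size => [|c r] //= /andP[c0 _] _; exists c, r.
Qed.

Lemma acc_nil : acc cs [::].
Proof. by have [c [r [-> _]]] := cs_cons. Qed.

Lemma acc_cons0 a : acc cs (0%N :: a) = acc cs a.
Proof. by have [c [r [csE c0]]] := cs_cons; rewrite {1}csE /= c0. Qed.

Lemma weights_gt0 n : (0 < n)%N -> (0 < size (weights n))%N.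
Proof.
case: n => // n _; rewrite size_map -has_predT.
(* The word 0...01. If c_1 = 1 its last digit matches c_1, which is accepted because a second entry
   remains to be matched. *)
apply/hasP; exists (nseq n 0%N ++ [:: 1%N]) => //.
rewrite mem_filter mem_words last_cat size_cat size_nseq addn1 eqxx/=.
elim: n => [|n IH]; last by rewrite acc_cons0.
have := cs_size; have [c [r [csE c0]]] := cs_cons; rewrite {1 2}csE /= => r0.
by case: ltnP => [_|c1]; [exact: acc_nil|rewrite eqn_leq c0 c1; case: r r0 {csE}].
Qed.

Lemma mem_blocks i w : ((i, w) \in blocks) =
  [&& (0 < i <= size cs)%N, (sumn (take i.-1 cs) <= w)%N
    & (w < sumn (take i.-1 cs) + nth 0%N cs i.-1)%N].
Proof.
apply/allpairsPdep/idP => /= [[j [d [+ + [-> ->]]]]|].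
  by rewrite !mem_iota !add0n /= leq_addr ltn_add2l => -> ->.
case: i => // i /and3P[ik wi wd]; exists i, (w - sumn (take i cs))%N.
by move: ik => /= ik; rewrite !mem_iota !add0n /= ik subnKC// ltn_subLR.
Qed.

Lemma blocks_len : {in blocks, forall b, (0 < b.1 <= size cs)%N}.
Proof. by move=> [i w]; rewrite mem_blocks => /and3P[]. Qed.

Lemma blocks_all j : (0 < j <= size cs)%N -> exists2 b, b \in blocks & b.1 = j.
Proof.
move=> jk; exists (j, sumn (take j.-1 cs)) => //.
rewrite mem_blocks jk leqnn/= -[X in (X < _)%N]addn0 ltn_add2l nth_cs_gt0//.
by case: j jk.
Qed.

Lemma blocks_unit : (1, 0)%N \in blocks.
Proof. by rewrite mem_blocks take0/= ltnW// add0n nth_cs_gt0// ltnW. Qed.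

Lemma blocks_pos : has (fun b => 0 < b.2)%N blocks.
Proof.
(* The block c_1, 0. *)
apply/hasP; exists (2, sumn (take 1 cs)) => //=.
  by rewrite mem_blocks cs_size leqnn/= -[X in (X < _)%N]addn0 ltn_add2l nth_cs_gt0.
by have [c [r [-> c0]]] := cs_cons; rewrite /= take0 addn0.
Qed.

(** * Values of words in base 1/y *)

Section value.
Variable R : realType.
Variable y : R.
Hypothesis y0 : 0 < y.

Definition value (a : seq nat) : R := foldr (fun d v => y * (d%:R + v)) 0 a.

Lemma valueE a N : (size a <= N)%N ->
  value a = \sum_(i < N) y ^+ i.+1 * (nth 0 a i)%:R.
Proof.
elim: a N => [|d a IH] [|N] //=; rewrite ?big_ord0//.
  by move=> _; rewrite big1// => i _; rewrite nth_nil mulr0.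
move=> aN; rewrite big_ord_recl/= expr1 mulrDr; congr (_ + _).
by rewrite (IH N)// mulr_sumr; apply: eq_bigr => i _; rewrite mulrA -exprS.
Qed.

Lemma value_ge0 a : 0 <= value a.
Proof. by elim: a => //= d a IH; rewrite mulr_ge0 ?addr_ge0// ltW. Qed.

Hypothesis value_cs : value cs = 1.

Lemma sum_blocks : \sum_(b <- blocks) y ^+ b.1 = 1.
Proof.
rewrite big_allpairs_dep/= -value_cs (valueE (leqnn _)).
rewrite -[X in iota 0 X]subn0 -/(index_iota 0 _) big_mkord; apply: eq_bigr => i _.
by rewrite big_const_seq count_predT size_iota iter_addr_0 mulr_natr.
Qed.

(** At the first digit below that of [r] at least 1 is lost, while the rest, read from the initial
    state, is worth less than value(cs) = 1. *)
Lemma acc_value_lt r a : all (leq 1) r -> acc r a -> value a < value r.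
Proof.
elim: a r => [|d a IH] [|c r] //= /andP[c0 r0].
  by move=> _; rewrite mulr_gt0// ltr_pwDl ?ltr0n// value_ge0.
rewrite ltr_pM2l//; case: ifP => [dc /(IH _ cs_pos)|_ /andP[/eqP <- /(IH _ r0)]].
  rewrite value_cs => a1; rewrite (@lt_le_trans _ _ (d%:R + 1))// ?ltrD2l//.
  by rewrite natr1 (@le_trans _ _ c%:R) ?ler_nat// lerDl value_ge0.
by rewrite ltrD2l.
Qed.

Hypothesis cs_sorted : sorted geq cs.

(** As cs is weakly decreasing, its tails are dominated by cs digit by digit. *)
Lemma value_drop j : value (drop j cs) <= 1.
Proof.
rewrite -value_cs (valueE (leqnn (size cs))).
rewrite (@valueE _ (size cs)) ?size_drop ?leq_subr//.
apply: ler_sum => i _; rewrite ler_wpM2l ?exprn_ge0 ?(ltW y0)// ler_nat nth_drop.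
have [ji|ji] := ltnP (j + i) (size cs); last by rewrite nth_default.
apply: (sorted_leq_nth _ _ _ cs_sorted); rewrite ?inE//.
- by move=> b a d ba db; exact: leq_trans db ba.
- exact: leqnn.
- by rewrite leq_addl.
Qed.

Lemma acc_value_lt1 j a : acc (drop j cs) a -> value a < 1.
Proof.
move=> ha; apply: lt_le_trans (value_drop j); apply: acc_value_lt ha.
by apply/allP => c /mem_drop /(allP cs_pos).
Qed.

Lemma acc_tail j d a : acc (drop j cs) (d :: a) ->
  exists j', acc (drop j' cs) a.
Proof.
case E : (drop j cs) => [|c r] //=; case: ifP => [_ h|_ /andP[_ h]].
  by exists 0%N; rewrite drop0.
by exists j.+1; rewrite -addn1 addnC -drop_drop E drop1.
Qed.

(** The value of each tail lies in [0,1), so the first digit is the integer part of value / y. The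
    states may differ, since the bound holds from every state. *)
Lemma acc_value_inj a b j j' : size a = size b ->
  acc (drop j cs) a -> acc (drop j' cs) b -> value a = value b -> a = b.
Proof.
elim: a b j j' => [|d a IH] [|e b] j j' // [sab] ha hb /= /(mulfI _) E.
have [ja ha'] := acc_tail ha; have [jb hb'] := acc_tail hb.
have {E} : d%:R + value a = e%:R + value b by apply: E; rewrite gt_eqF.
have := acc_value_lt1 ha'; have := acc_value_lt1 hb'.
have := value_ge0 a; have := value_ge0 b => b0 a0 b1 a1 E.
have de : d = e.
  by apply/eqP; rewrite eqn_leq; apply/andP; split;
    rewrite -ltnS -(ltr_nat R) -natr1; lra.
by rewrite de; congr cons; apply: (IH b ja jb) => //; move: E; rewrite de => /addrI.
Qed.

End value.

End words.

(** * Uniform measures on finite sets *)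

Section uniform_measure.
Variables (R : realType) (k : nat) (s : seq (Zvec k)).
Hypothesis s_uniq : uniq s.
Hypothesis s_size : (0 < size s)%N.
Local Notation P := (unif R [set` s]).

Lemma counting_seq (t : seq (Zvec k)) : uniq t ->
  @counting _ R [set` t] = ((size t)%:R)%:E.
Proof.
move=> tu; rewrite /counting asboolT; last exact: finite_seq.
congr (_%:R%:E); apply/perm_size/uniq_perm => //.
by move=> v; rewrite in_fset_set ?mem_setE//; exact: finite_seq.
Qed.

Let size_neq0 : (size s)%:R != 0 :> R.
Proof. by rewrite pnatr_eq0 -lt0n. Qed.

Lemma unif_seqE (A : set (Zvec k)) :
  P A = ((count (mem A) s)%:R / (size s)%:R)%:E.
Proof.
pose m : {measure set (Zvec k) -> \bar R} :=
  mrestr (@counting (Zvec k) R) (measurable_Zvec [set` s]).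
have E B : m B = ((count (mem B) s)%:R)%:E.
  rewrite /m /= /mrestr (_ : B `&` _ = [set` [seq v <- s | v \in B]]).
    by rewrite counting_seq ?filter_uniq// size_filter.
  apply/seteqP; split=> v /=; rewrite mem_filter.
    by case=> Bv ->; rewrite andbT; apply/mem_set.
  by case/andP => /set_mem.
have -> : P A = mnormalize m (\d_ (point : Zvec k)) A by [].
rewrite /mnormalize !E.
have -> : count (mem [set: Zvec k]) s = size s.
  by rewrite -[RHS]count_predT; apply: eq_count => v; rewrite /= in_setT.
by rewrite eqe (negbTE size_neq0)/= -[LHS]/(m A * _)%E E -EFinM.
Qed.

Lemma unif_integral (f : Zvec k -> R) :
  (\int[P]_v (f v)%:E = ((\sum_(v <- s) f v) / (size s)%:R)%:E)%E.
Proof.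
(* The null complement and the point masses determine the integral. *)
suff H (Q : probability (Zvec k) R) : Q (~` [set` s]) = 0%E ->
    {in s, forall v, Q [set v] = ((size s)%:R^-1)%:E} ->
    (\int[Q]_v (f v)%:E = ((\sum_(v <- s) f v) / (size s)%:R)%:E)%E.
  apply: H => [|v vs].
    rewrite unif_seqE (_ : count _ _ = 0%N) ?mul0r//; apply/eqP.
    rewrite -leqn0 leqNgt -has_count; apply/negP => /hasP[v vs].
    by rewrite /= in_setC => /negP; apply; apply/mem_set.
  rewrite unif_seqE (_ : count _ _ = count_mem v s).
    by rewrite count_uniq_mem// vs mul1r.
  apply: eq_count => w /=; apply/idP/eqP => [/set_mem//|->].
  exact/mem_set.
move=> QsC Qv.
have -> : [set: Zvec k] = [set` s] `|` ~` [set` s] by rewrite setUCr.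
rewrite integral_setU_EFin//=; last exact/disj_setPCl.
rewrite [X in (_ + X)%E]null_set_integral// adde0.
have -> : [set` s] = \big[setU/set0]_(v <- s) [set v].
  rewrite -bigcup_seq; apply/seteqP; split=> [v vs|v [w ws ->]//].
  by exists v.
rewrite integral_bigsetU_EFin//=; last by move=> v w _ _ [u [-> ->]].
transitivity (\sum_(v <- s) (f v / (size s)%:R)%:E)%E.
  rewrite big_seq [RHS]big_seq; apply: eq_bigr => v vs.
  rewrite (eq_integral (cst (f v)%:E)); last by move=> w; rewrite inE/= => ->.
  by rewrite integral_cst//= Qv.
by rewrite sumEFin mulr_suml.
Qed.

Lemma unif_expectation (f : Zvec k -> R) :
  ('E_P[f])%E = ((\sum_(v <- s) f v) / (size s)%:R)%:E.
Proof. by rewrite unlock unif_integral. Qed.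

Lemma unif_variance (f : Zvec k -> R) :
  ('V_P[f])%E = ((\sum_(v <- s) (f v - (\sum_(v <- s) f v) / (size s)%:R) ^+ 2)
    / (size s)%:R)%:E.
Proof.
rewrite /variance unlock unif_expectation/= unif_expectation.
by do 2 congr (_%:E); congr (_ / _); apply: eq_bigr => v _; rewrite expr2.
Qed.

Lemma unif_cdf (f : Zvec k -> R) (x : R) :
  cdf (standardize P f : {RV P >-> R}) x =
  ((count (fun v => standardize P f v <= x) s)%:R / (size s)%:R)%:E.
Proof.
rewrite /cdf /distribution/= /pushforward unif_seqE; congr (_%:R / _)%:E.
apply: eq_count => v /=; apply/idP/idP => [/set_mem/=|h].
  by rewrite in_itv.
by apply/mem_set; rewrite /= in_itv.
Qed.

End uniform_measure.

(** * Satisfying sequences and their expansions *)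

(** Intermediate values: the polynomial is 0 at 0, and at 1 it is the digit sum, which is at least
    2. *)
Lemma value_root (R : realType) (cs : seq nat) :
  all (leq 1) cs -> (1 < size cs)%N ->
  exists2 y : R, 0 < y < 1 & value y cs = 1.
Proof.
move=> cs_pos cs_size.
pose p : {poly R} := foldr (fun d q => 'X * (d%:R%:P + q)) 0 cs - 1.
have pE x : p.[x] = value x cs - 1.
  rewrite /p hornerD hornerN hornerC; congr (_ - _).
  by elim: (cs) => [|d s IH] /=; rewrite ?horner0// hornerM hornerX hornerD hornerC IH.
have v0 : value 0 cs = 0 :> R by case: (cs) => //= *; rewrite mul0r.
have v1 : 1 < value 1 cs :> R.
  case: cs cs_pos cs_size {p pE v0} => [|a [|b s]] //= /and3P[a0 b0 _] _.
  have a1 : 1 <= a%:R :> R by rewrite ler1n.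
  have b1 : 1 <= b%:R :> R by rewrite ler1n.
  by have := value_ge0 (ltr01 : 0 < 1 :> R) s; rewrite /value !mul1r; lra.
have [|x /andP[x0 x1] /rootP] := @poly_ivt R p 0 1 ler01.
  by rewrite !pE v0; apply/andP; split; lra.
rewrite pE => /eqP; rewrite subr_eq0 => /eqP vx.
exists x; rewrite // !lt_neqAle x0 x1 !andbT; apply/andP; split.
  by apply/negP => /eqP E; move: vx; rewrite -E v0 => /eqP; rewrite eq_sym oner_eq0.
by apply/negP => /eqP E; move: v1; rewrite -[X in value X]E vx ltxx.
Qed.

Section satisfying_words.
Variables (k : nat) (c : 'I_k -> int).
Hypothesis k_ge2 : (2 <= k)%N.
Hypothesis c_decreasing : forall i j : 'I_k, (i <= j)%N -> c j <= c i.
Hypothesis c_last : forall i : 'I_k, i.+1 = k -> c i = 1.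

Definition digits : seq nat := [seq `|c i|%N | i <- enum 'I_k].
Local Notation cs := digits.

Lemma c_ge1 i : 1 <= c i.
Proof.
have kk : (k.-1 < k)%N by rewrite prednK// ltnW.
rewrite -(c_last (i := Ordinal kk)) ?c_decreasing//=; last by rewrite prednK// ltnW.
by rewrite -ltnS prednK// ltnW.
Qed.

Lemma size_digits : size cs = k.
Proof. by rewrite size_map size_enum_ord. Qed.

Lemma nth_digits (i : 'I_k) : (nth 0%N cs i)%:Z = c i.
Proof.
rewrite (nth_map i) ?size_enum_ord// nth_ord_enum gez0_abs//.
by rewrite (le_trans _ (c_ge1 i)).
Qed.

Lemma digits_pos : all (leq 1) cs.
Proof.
apply/allP => _ /mapP[i _ ->]; rewrite absz_gt0.
by apply/eqP => c0; have := c_ge1 i; rewrite c0.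
Qed.

Lemma digits_size : (1 < size cs)%N.
Proof. by rewrite size_digits. Qed.

Lemma digits_sorted : sorted geq cs.
Proof.
apply/(sortedP 0%N) => i; rewrite size_digits => ik.
have := c_decreasing (i := Ordinal (ltnW ik)) (j := Ordinal ik) (leqnSn i).
by rewrite -!nth_digits.
Qed.

Lemma mkseqS (f : nat -> nat) n : mkseq f n.+1 = f 0%N :: mkseq (fun i => f i.+1) n.
Proof. by rewrite /mkseq /= (iotaDl 1 0) -map_comp. Qed.

Lemma acc_block r (f : nat -> nat) s n : (s < size r)%N ->
  (forall i, (i < s)%N -> f i = nth 0%N r i) -> (f s < nth 0%N r s)%N ->
  (forall m, acc cs cs (mkseq (fun i => f (s.+1 + i)%N) m)) ->
  acc cs r (mkseq f n).
Proof.
elim: s r f n => [|s IH] [|d r] f [|n] // sr fr fs acct; rewrite mkseqS/=.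
  by rewrite [(_ < _)%N]fs; exact: acct.
rewrite fr//= ltnn eqxx/=; apply: IH => // i si; exact: (fr i.+1).
Qed.

Lemma satisfying_acc f : satisfying c f -> forall n, acc cs cs (mkseq f n).
Proof.
(* Leading zeros leave the automaton in its initial state because 0 < c_1; this absorbs the [l]
   zeros of a block. *)
have acc0 (g : nat -> nat) l : (forall i, (i < l)%N -> g i = 0%N) ->
    (forall m, acc cs cs (mkseq (fun i => g (l + i)%N) m)) ->
    forall m, acc cs cs (mkseq g m).
  elim: l g => [|l IH] g g0 gacc m; first exact: gacc.
  case: m => [|m]; first exact: acc_nil digits_pos digits_size.
  rewrite mkseqS g0// acc_cons0 ?digits_pos ?digits_size//.
  by apply: IH => [i il|m']; [exact: (g0 i.+1)|exact: gacc].
have accz g n : (forall i, g i = 0%N) -> acc cs cs (mkseq g n).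
  elim: n g => [|n IH] g g0; first exact: acc_nil digits_pos digits_size.
  by rewrite mkseqS g0 acc_cons0 ?digits_pos ?digits_size// IH.
elim=> {f} [f f0|f p fp fp0 pk fc|f s l _ fc fs f0 _ IH] n.
- exact: accz.
(* A proper prefix of c followed by zeros is a block too: its next digit 0 lies below the next entry
   of c. *)
- apply: (@acc_block _ _ p.+1); rewrite ?size_digits//.
  + move=> i; rewrite ltnS => ip; have ik := leq_ltn_trans ip (ltnW pk).
    have := fc (Ordinal ik) ip.
    by rewrite -nth_digits => -[].
  + rewrite fp0//; apply: nth_cs_gt0 digits_pos _ _.
    by rewrite size_digits.
  + by move=> m; apply: accz => i; apply: fp0; rewrite addSnnS leq_addr.
- apply: (@acc_block _ _ s); rewrite ?size_digits//.
  + move=> i si; have ik := ltn_trans si (ltn_ord s).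
    have := fc (Ordinal ik) si.
    by rewrite -nth_digits => -[].
  + by move: fs; rewrite -nth_digits.
  + apply: (acc0 _ l) => [i il|m].
      by apply: f0; rewrite ltnS leq_addr/= addSn -addnS leq_add2l.
    by under eq_mkseq do rewrite addnA.
Qed.

(** A word that ends while still matching [r] reads as 0 beyond its end, and 0 is below the next
    entry of [r] by positivity. *)
Lemma acc_split r a : all (leq 1) r -> acc cs r a -> exists s,
  [/\ (s < size r)%N, forall i, (i < s)%N -> nth 0%N a i = nth 0%N r i,
     (nth 0%N a s < nth 0%N r s)%N & acc cs cs (drop s.+1 a)].
Proof.
have an := acc_nil digits_pos digits_size.
elim: a r => [|d a IH] [|x r] //= /andP[x0 r0].
  by move=> _; exists 0%N.
case: ifP => [dx aa|_ /andP[/eqP -> /(IH _ r0)[s [sr ar as_ acs]]]].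
  by exists 0%N; rewrite drop0.
by exists s.+1; split => // -[|i] //= is_; exact: ar.
Qed.

Lemma acc_satisfying a : acc cs cs a -> satisfying c (nth 0%N a).
Proof.
move: {2}(size a) (leqnn (size a)) => n; elim: n a => [|n IH] a.
  by rewrite leqn0 => /nilP -> _; apply: SatZero => i; rewrite nth_nil.
(* A zero word goes to [SatZero], as [SatBlock] demands a nonzero entry; blocks are then peeled off
   with l = 0. *)
move=> an aa; have [/existsP[j aj]|/existsPn az] :=
  boolP [exists j : 'I_(size a), (0 < nth 0%N a j)%N]; last first.
  apply: SatZero => i; have [ia|ai] := ltnP i (size a); last exact: nth_default.
  by have := az (Ordinal ia); rewrite -eqn0Ngt => /eqP.
have [s [sr ar as_ acs]] := acc_split digits_pos aa.
rewrite size_digits in sr.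
apply: (@SatBlock _ _ _ (Ordinal sr) 0%N).
- by exists j.
- by move=> i is_; rewrite ar// nth_digits.
- by rewrite -nth_digits.
- by move=> i; rewrite addn0 => /andP[/leq_trans h /h]; rewrite ltnn.
- rewrite (_ : (fun i => _) = nth 0%N (drop s.+1 a)); last first.
    by apply/funext => i; rewrite nth_drop addn0.
  apply: IH => //; rewrite size_drop leq_subLR addSn.
  by rewrite (leq_trans an)// ltnS leq_addl.
Qed.

(** * Uniqueness of expansions *)

Variable X : int -> Zvec k.
Hypothesis X_rec : is_recurrence_seq c X.

Section uniqueness.
Variables (R : realType) (y : R).
Hypothesis y0 : 0 < y.
Hypothesis value_digits : value y cs = 1.

(** The additive map sending e_i to y^i, hence X_(-i) to y^i for 1 <= i < k. *)
Definition vec_value (v : Zvec k) : R :=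
  \sum_(i < k.-1) ((v : 'rV[int]_k.-1) 0 i)%:~R * y ^+ i.+1.

Lemma vec_valueD : {morph vec_value : u v / u + v}.
Proof.
by move=> u v; rewrite -big_split; apply: eq_bigr => i _; rewrite mxE intrD mulrDl.
Qed.

Lemma vec_value0 : vec_value 0 = 0.
Proof. by rewrite /vec_value big1// => i _; rewrite mxE mul0r. Qed.

Lemma vec_value_sum I (s : seq I) (F : I -> Zvec k) :
  vec_value (\sum_(i <- s) F i) = \sum_(i <- s) vec_value (F i).
Proof. exact: (big_morph _ vec_valueD vec_value0). Qed.

Lemma vec_valueZ a v : vec_value (a *: v) = a%:~R * vec_value v.
Proof.
by rewrite mulr_sumr; apply: eq_bigr => i _; rewrite mxE intrM mulrA.
Qed.

Lemma vec_valueMn v n : vec_value (v *+ n) = vec_value v *+ n.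
Proof.
by elim: n => [|n IH]; rewrite ?mulr0n ?vec_value0// !mulrS vec_valueD IH.
Qed.

(** X_(-m) and y^m obey the same integer recurrence, and c_k = 1 allows solving it for the term of
    index m. The initial differences are 0, except for -1 at m = 0, which is why the congruence is
    only modulo the integers. *)
Lemma vec_value_X (m : nat) : vec_value (X (- m%:Z)) - y ^+ m \is a Num.int.
Proof.
have [X0 Xe XS] := X_rec.
elim/ltn_ind: m => m IH; have [mk|km] := ltnP m k.
  case: m mk {IH} => [|m] mk; first by rewrite oppr0 X0 vec_value0 sub0r rpredN expr0 int_num1.
  have mk1 : (m < k.-1)%N by rewrite -ltnS prednK// ltnW.
  rewrite -[m]/(nat_of_ord (Ordinal mk1)) Xe /vec_value (bigD1 (Ordinal mk1))//=.
  rewrite mxE !eqxx/= mul1r big1 ?addr0 ?subrr ?rpred0// => i im.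
  by rewrite mxE (negbTE im) andbF mul0r.
have kk : (k.-1 < k)%N by rewrite prednK// ltnW.
pose l := Ordinal kk; pose n := (m - k)%N.
have mE : m = (n + k)%N by rewrite subnK.
have lE : (l.+1 = k)%N by rewrite /= prednK// ltnW.
have yn : y ^+ n = \sum_(i < k) (c i)%:~R * y ^+ (n + i.+1).
  rewrite -[LHS]mulr1 -[X in y ^+ n * X]value_digits (valueE y (leqnn _)).
  rewrite size_digits mulr_sumr.
  by apply: eq_bigr => i _; rewrite -(nth_digits i) mulrA -exprD mulrC.
have Xn : vec_value (X (- n%:Z)) =
    \sum_(i < k) (c i)%:~R * vec_value (X (- (n + i.+1)%:Z)).
  rewrite {1}XS vec_value_sum; apply: eq_bigr => i _.
  by rewrite vec_valueZ PoszD opprD.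
have : vec_value (X (- n%:Z)) - y ^+ n =
    \sum_(i < k) (c i)%:~R * (vec_value (X (- (n + i.+1)%:Z)) - y ^+ (n + i.+1)).
  by rewrite Xn yn -sumrB; apply: eq_bigr => i _; rewrite mulrBr.
rewrite (bigD1 l)//= (c_last lE) mul1r prednK ?(ltnW k_ge2)// -mE.
set S := \sum_(i < k | _) _ => E.
have -> : vec_value (X (- m%:Z)) - y ^+ m = vec_value (X (- n%:Z)) - y ^+ n - S.
  by rewrite E addrK.
rewrite rpredB ?IH//; first by rewrite mE -addn1 leq_add2l ltnW.
apply: rpred_sum => i il; rewrite rpredM ?intr_int// IH// mE ltn_add2l.
rewrite ltn_neqAle ltn_ord andbT; apply: contra il => /eqP ik.
by apply/eqP/val_inj/succn_inj; rewrite ik lE.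
Qed.

Lemma fsbig_nat_support (V : nmodType) (F : nat -> V) N :
  (forall n, (N <= n)%N -> F n = 0) ->
  \sum_(n \in [set: nat]) F n = \sum_(n < N) F n.
Proof.
move=> F0; rewrite fsbig_ord; apply/esym/fsbig_widen => // n [_ /=].
by move=> /negP; rewrite -leqNgt; exact: F0.
Qed.

Lemma vec_value_expansion (f : nat -> nat) N :
  (forall n, (N <= n)%N -> f n = 0%N) ->
  vec_value (\sum_(n \in [set: nat]) X (- (n.+1)%:Z) *+ f n)
    - value y (mkseq f N) \is a Num.int.
Proof.
move=> f0; rewrite (@fsbig_nat_support _ _ N); last by move=> n /f0 ->.
rewrite vec_value_sum (@valueE _ _ _ N) ?size_mkseq// -sumrB.
apply: rpred_sum => i _; rewrite vec_valueMn nth_mkseq// mulr_natr -mulrnBl.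
by rewrite rpredMn// vec_value_X.
Qed.

(** Padded to a common length, both words have values in [0,1) that agree modulo the integers, hence
    are equal; [acc_value_inj] concludes. *)
Lemma is_SR_unique v f g : is_SR c X v f -> is_SR c X v g -> f = g.
Proof.
move=> [satf vf] [satg vg].
have [Nf f0] := satisfying_finite_support satf.
have [Ng g0] := satisfying_finite_support satg.
pose N := maxn Nf Ng.
have {}f0 n : (N <= n)%N -> f n = 0%N by move=> Nn; apply: f0; rewrite (leq_trans _ Nn)// leq_maxl.
have {}g0 n : (N <= n)%N -> g n = 0%N by move=> Nn; apply: g0; rewrite (leq_trans _ Nn)// leq_maxr.
have accf := satisfying_acc satf N; have accg := satisfying_acc satg N.
have lt1 a : acc cs cs a -> value y a < 1.
  by move=> aa; rewrite -value_digits; apply: acc_value_lt aa => //; exact: digits_pos.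
have := rpredB (vec_value_expansion g0) (vec_value_expansion f0).
rewrite -vf -vg (_ : _ - _ = value y (mkseq f N) - value y (mkseq g N)); last by ring.
move=> /intrP[m mE].
have vfg : value y (mkseq f N) = value y (mkseq g N).
  have := lt1 _ accf; have := lt1 _ accg.
  have := value_ge0 y0 (mkseq f N); have := value_ge0 y0 (mkseq g N).
  move=> g_ge0 f_ge0 g_lt1 f_lt1.
  have m1 : m < 1 by rewrite -(ltr_int R) -mE; lra.
  have m2 : -1 < m by rewrite -(ltr_int R) -mE; lra.
  have m0 : m = 0 by lia.
  by move: mE; rewrite m0 => /eqP; rewrite subr_eq0 => /eqP ->.
have drop0cs a : acc cs cs a -> acc cs (drop 0 cs) a by rewrite drop0.
have E : mkseq f N = mkseq g N.
  apply: (acc_value_inj digits_pos y0 value_digits digits_sorted _ _ _ vfg).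
  - by rewrite !size_mkseq.
  - exact: drop0cs accf.
  - exact: drop0cs accg.
apply/funext => n; have [nN|Nn] := ltnP n N; last by rewrite f0// g0.
by rewrite -(nth_mkseq 0%N f nN) E nth_mkseq.
Qed.

(** * Words of length n and the set R_n *)

Definition expansion (a : seq nat) : Zvec k :=
  \sum_(n \in [set: nat]) X (- (n.+1)%:Z) *+ nth 0%N a n.

Lemma is_SR_expansion a : acc cs cs a -> is_SR c X (expansion a) (nth 0%N a).
Proof. by move=> aa; split => //; exact: acc_satisfying. Qed.

Lemma SR_expansion a : acc cs cs a -> SR c X (expansion a) = nth 0%N a.
Proof.
move=> aa; apply: is_SR_unique (is_SR_expansion aa).
exact: (@xgetPex _ _ [set f | is_SR c X (expansion a) f] (ex_intro _ _ (is_SR_expansion aa))).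
Qed.

Lemma summands_expansion a : acc cs cs a ->
  summands c X R (expansion a) = (sumn a)%:R.
Proof.
move=> aa; rewrite /summands SR_expansion// (@fsbig_nat_support _ _ (size a)).
  by rewrite sumnE (big_nth 0%N) big_mkord natr_sum.
by move=> n an; rewrite nth_default.
Qed.

Definition last_words n : seq (seq nat) :=
  [seq a <- words cs n cs | (0 < last 0%N a)%N].

Lemma last_wordsP n a : a \in last_words n ->
  [/\ acc cs cs a, size a = n & (0 < nth 0%N a n.-1)%N].
Proof.
rewrite mem_filter mem_words => /and3P[+ /eqP sa aa].
by rewrite -nth_last sa.
Qed.

Lemma expansion_inj n : {in last_words n &, injective expansion}.
Proof.
move=> a b /last_wordsP[aa sa _] /last_wordsP[bb sb _] E.
apply: (@eq_from_nth _ 0%N) => [|i _]; first by rewrite sa sb.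
by rewrite -SR_expansion// E SR_expansion.
Qed.

Lemma Rset_expansion n : (0 < n)%N ->
  Rset c X n = [set` [seq expansion a | a <- last_words n]].
Proof.
move=> n0; apply/seteqP; split=> v /=.
  case=> -[srv v0] /not_andP[//|/existsNP[i /not_implyP[ni /eqP vi]]].
  pose a := mkseq (SR c X v) n.
  have aE : nth 0%N a = SR c X v.
    apply/funext => j; have [jn|nj] := ltnP j n; first by rewrite nth_mkseq.
    by rewrite nth_default ?size_mkseq// v0.
  (* Not being in D_(n-1) yields a nonzero digit at some i >= n - 1; with v in D_n it can only be
     the 0-based index n - 1, the last digit. *)
  have iE : i = n.-1.
    have [ni'|ni'] := ltnP i n; last by rewrite v0 ?eqxx in vi.
    by apply/eqP; rewrite eqn_leq ni andbT -ltnS prednK.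
  apply/mapP; exists a.
    rewrite mem_filter mem_words size_mkseq eqxx/= -nth_last size_mkseq aE.
    by rewrite -iE lt0n vi; apply: satisfying_acc; case: srv.
  by case: srv => _ {1}->; rewrite /expansion aE.
case/mapP => a /last_wordsP[aa sa an] ->; split.
  rewrite /Dset/= SR_expansion//; split; first exact: is_SR_expansion.
  by move=> i ni; rewrite nth_default// sa.
by case=> _ /(_ n.-1 (leqnn _)); rewrite SR_expansion// => E; rewrite E in an.
Qed.

End uniqueness.

End satisfying_words.

(** * Linear growth and final assembly *)

Lemma linear_growth_eqTheta (R : realType) (u : nat -> R) (a C : R) :
  0 < a -> 0 <= C -> (forall n, (0 < n)%N -> `|u n - a * n%:R| <= C) ->
  (u : nat -> R^o) =Theta_\oo (fun n => n%:R : R^o).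
Proof.
move=> a0 C0 uC; rewrite eqThetaE qualifE; apply/asboolP.
(* The lower constant works once a n > 2 C, the upper one as soon as n >= 1. *)
exists (a / 2, a + C) => /=; first by rewrite divr_gt0//= ltr_pwDl.
near=> n.
have n0 : (0 < n)%N by near: n; exact: nbhs_infty_gt.
have nC : 2 * C / a < n%:R by near: n; exact: nbhs_infty_gtr.
have n1 : 1 <= n%:R :> R by rewrite ler1n.
have {}nC : 2 * C < a * n%:R by rewrite [ltRHS]mulrC -ltr_pdivrMr.
have {uC} := uC n n0; rewrite normr_nat ler_norml => /andP[h1 h2].
have Cn : C <= C * n%:R by rewrite ler_peMr.
have u0 : 0 <= u n by lra.
by rewrite ger0_norm//; split; lra.
Unshelve. all: by end_near.
Qed.

Theorem theorem3p5 (R : realType) (k : nat) (c : 'I_k -> int)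
    (X : int -> Zvec k)
    (k_ge2 : (2 <= k)%N)
    (c_decreasing : forall i j : 'I_k, (i <= j)%N -> c j <= c i)
    (c_last : forall i : 'I_k, i.+1 = k -> c i = 1)
    (X_rec : is_recurrence_seq c X) :
  let P n : probability (Zvec k) R := unif R (Rset c X n) in
  let K : Zvec k -> R := summands c X R in
  [/\ (fun n => fine 'E_(P n)[K]%E : R^o) =Theta_\oo (fun n => n%:R : R^o),
      (fun n => fine 'V_(P n)[K]%E : R^o) =Theta_\oo (fun n => n%:R : R^o)
    & cvg_in_distribution P (fun n => standardize (P n) K)
        (@normal_prob R 0 1)].
Proof.
move=> P K; pose cs := digits c.
have cs_pos : all (leq 1) cs by exact: digits_pos.
have cs_size : (1 < size cs)%N by exact: digits_size.
have [y y01 vy] := value_root R cs_pos cs_size.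
have /andP[y0 _] := y01.
pose L := weights cs.
pose S n := [seq expansion X a | a <- last_words c n].
have RS n : (0 < n)%N -> Rset c X n = [set` S n].
  exact: (Rset_expansion k_ge2 c_decreasing c_last X_rec y0 vy).
have S_uniq n : uniq (S n).
  rewrite map_inj_in_uniq ?filter_uniq ?uniq_words//.
  exact: (expansion_inj k_ge2 c_decreasing c_last X_rec y0 vy).
have S_size n : size (S n) = size (L n) by rewrite !size_map.
have L0 n : (0 < n)%N -> (0 < size (L n))%N by exact: weights_gt0.
have S0 n : (0 < n)%N -> (0 < size (S n))%N by rewrite S_size; exact: L0.
have KE n a : a \in last_words c n -> K (expansion X a) = (sumn a)%:R.
  case/last_wordsP => aa _ _.
  exact: (summands_expansion k_ge2 c_decreasing c_last X_rec y0 vy aa).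
(* Through [K], the uniform law on R_n becomes the uniform law on the list [L n]. *)
have sumK n (F : R -> R) : \sum_(v <- S n) F (K v) = \sum_(w <- L n) F w%:R.
  rewrite !big_map -/(last_words c n) big_seq [RHS]big_seq.
  by apply: eq_bigr => a /KE ->.
have countK n (p : pred R) : count (p \o K) (S n) = count (fun w => p w%:R) (L n).
  rewrite !count_map -/(last_words c n); apply: eq_in_count => a /KE /= ->.
  by [].
have meanE n : (0 < n)%N -> fine ('E_(P n)[K])%E = meanL R L n.
  move=> n0; rewrite /P RS// unif_expectation ?S0//= S_size.
  by rewrite (sumK n id).
have varE n : (0 < n)%N -> fine ('V_(P n)[K])%E = varL R L n.
  move=> n0; rewrite /P RS// unif_variance ?S0//= S_size (sumK n id).
  by rewrite (sumK n (fun t => (t - meanL R L n) ^+ 2)).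
have k0 : (0 < size cs)%N by rewrite ltnW.
have q_sum := sum_blocks vy.
have L_rec n (F : nat -> R) := @weights_rec cs R n F.
have bl_len := @blocks_len cs.
have bl_all := blocks_all cs_pos.
have bl_pos := blocks_pos cs_pos cs_size.
have bl_unit := blocks_unit cs_pos cs_size.
have [C C0 moms] := moments_linear y01 k0 bl_len bl_all q_sum L_rec L0 bl_pos bl_unit.
split.
- apply: linear_growth_eqTheta C0 _; first exact: (mu_gt0 y01 bl_len q_sum bl_pos).
  by move=> n n0; rewrite meanE//; case: (moms n n0).
- apply: linear_growth_eqTheta C0 _.
    exact: (sigma2_gt0 y01 bl_len q_sum bl_pos bl_unit).
  by move=> n n0; rewrite varE//; case: (moms n n0).
move=> x _.
pose p n (t : R) := (t - meanL R L n) / Num.sqrt (varL R L n) <= x.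
have cdfE n : (0 < n)%N -> cdf (standardize (P n) K : {RV P n >-> R}) x =
    ((count (fun w => p n w%:R) (L n))%:R / (size (L n))%:R)%:E.
  move=> n0.
  (* The set is generalised before rewriting because the type of the random variable depends on the
     measure. *)
  have E (A : set (Zvec k)) : A = [set` S n] ->
      cdf (standardize (unif R A) K : {RV unif R A >-> R}) x =
      ((count (fun v => standardize (unif R A) K v <= x) (S n))%:R
        / (size (S n))%:R)%:E.
    by move=> ->; rewrite unif_cdf// S0.
  rewrite E ?RS// S_size -countK; congr (_%:R / _)%:E; apply: eq_count => v.
  by rewrite /p /= -meanE// -varE// /P RS.
suff: cdf (standardize (P n) K : {RV P n >-> R}) x @[n --> \oo] --> (Phi x)%:E.
  by rewrite PhiE.
apply/fine_cvgP; split.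
  by near=> n; rewrite cdfE//; near: n; exact: nbhs_infty_gt.
apply: cvg_trans (cltL y01 k0 bl_len bl_all q_sum L_rec L0 bl_pos bl_unit (x := x)).
apply: near_eq_cvg; near=> n.
have n0 : (0 < n)%N by near: n; exact: nbhs_infty_gt.
by rewrite -[RHS]/(fine (cdf (standardize (P n) K : {RV P n >-> R}) x)) cdfE.
Unshelve. all: by end_near.
Qed.
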